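(* There are universal constants $c,C>0$ such that for every $n\in\mathbb N$ and $p\in[1,\infty]$ there is a normed space $\mathbf Y_p^n=(\mathbb R^n,\|\cdot\|_{\mathbf Y_p^n})$ that satisfies, for every $x\in\mathbb R^n\setminus\{0\}$, $$c\|x\|_{\ell_p^n}\le\|x\|_{\mathbf Y_p^n}\le C\|x\|_{\ell_p^n}\qquad\text{and}\qquad\frac{\mathrm{vol}_{n-1}\big(\mathrm{Proj}_{x^\perp}B_{\mathbf Y_p^n}\big)}{\mathrm{vol}_n\big(B_{\mathbf Y_p^n}\big)}\le C\,n^{\frac1p}.$$
   Context: $B_{\mathbf Y}$ is the closed unit ball of a normed space $\mathbf Y$; $\mathrm{Proj}_{x^\perp}$ is the orthogonal projection of $\mathbb R^n$ (with its standard Euclidean structure) onto the hyperplane $x^\perp$ orthogonal to $x$; $\mathrm{vol}_s$ is $s$-dimensional Hausdorff measure; $1/\infty=0$. *)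

(* Defs.v *)
(* MathComp / MathComp-Analysis; R^n is 'rV[R]_n. The topology and norm which
   the library puts on matrices (the sup norm) are not used: the Euclidean
   structure is given explicitly below. *)
From HB Require Import structures.
From mathcomp Require Import all_boot all_order all_algebra.
From mathcomp Require Import all_classical all_reals all_analysis.

Set Implicit Arguments.
Unset Strict Implicit.
Unset Printing Implicit Defensive.

Import Order.TTheory GRing.Theory Num.Theory.

Local Open Scope classical_set_scope.
Local Open Scope ring_scope.

Section Norms.
Context {R : realType} {n : nat}.
Implicit Types x y : 'rV[R]_n.

(* Nonnegativity follows from these three axioms. *)
Record is_norm (N : 'rV[R]_n -> R) : Prop := IsNorm {
  norm_triangle : forall x y, N (x + y) <= N x + N y ;
  norm_homogeneous : forall (a : R) x, N (a *: x) = `|a| * N x ;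
  norm_definite : forall x, N x = 0 -> x = 0 }.

Definition unit_ball (N : 'rV[R]_n -> R) : set 'rV[R]_n := [set x | N x <= 1].

(* Only used for 1 <= p <= +oo; the value at p = -oo is irrelevant. *)
Definition lp_norm (p : \bar R) x : R :=
  match p with
  | r%:E => (\sum_(i < n) `|x 0 i| `^ r) `^ r^-1
  | _ => \big[Num.max/0]_(i < n) `|x 0 i|
  end.

Definition dotp x y : R := \sum_(i < n) x 0 i * y 0 i.

Definition euclid_norm x : R := Num.sqrt (dotp x x).

(* Orthogonal projection of y onto the hyperplane orthogonal to x, for x != 0. *)
Definition proj_perp x y : 'rV[R]_n := y - (dotp y x / dotp x x) *: x.

End Norms.

Section Hausdorff.
Context {R : realType}.
Local Open Scope ereal_scope.

(* -oo on the empty set *)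
Definition diam {m} (U : set 'rV[R]_m) : \bar R :=
  ereal_sup [set (euclid_norm (x - y))%:E | x in U & y in U].

(* diam(U)^s with the usual conventions: the empty set has size 0, and, for
   s = 0, every nonempty set has size 1 (so that s = 0 gives counting measure). *)
Definition hausdorff_gauge {m} (s : nat) (U : set 'rV[R]_m) : \bar R :=
  if U == set0 then 0 else diam U ^+ s.

Definition hausdorff_premeasure {m} (s : nat) (d : R) (A : set 'rV[R]_m) :
    \bar R :=
  ereal_inf [set \sum_(0 <= k <oo) hausdorff_gauge s (U k) |
    U in [set U : (set 'rV[R]_m)^nat |
      A `<=` \bigcup_k U k /\ forall k, diam (U k) <= d%:E]].

Definition hausdorff_measure {m} (s : nat) (A : set 'rV[R]_m) : \bar R :=
  ereal_sup [set hausdorff_premeasure s d A | d in [set d : R | (0 < d)%R]].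

Definition unit_cube (s : nat) : set 'rV[R]_s :=
  [set x | forall i, (0 <= x 0%R i <= 1)%R].

(* s-dimensional Hausdorff measure in the normalization for which the unit cube
   of R^s has measure 1, i.e. for which it is Lebesgue measure on R^s. The
   normalization matters when volumes of different dimensions are compared: the
   constant relating vol s to hausdorff_measure s, namely the volume of a ball
   of diameter 1 in R^s, depends on s. *)
Definition vol {m} (s : nat) (A : set 'rV[R]_m) : \bar R :=
  hausdorff_measure s A / hausdorff_measure s (@unit_cube s).

End Hausdorff.

(* Main.v *)
Require Import Defs.
From HB Require Import structures.
From mathcomp Require Import all_boot all_order all_algebra.
From mathcomp Require Import all_classical all_reals all_analysis.
From mathcomp Require Import measurable_realfun ring lra.

Set Implicit Arguments.
Unset Strict Implicit.
Unset Printing Implicit Defensive.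

Import Order.TTheory GRing.Theory Num.Theory.

Local Open Scope classical_set_scope.
Local Open Scope ring_scope.

(** Let L be the dilate of the l_p ball that has the vector of ones on its
boundary: a bounded convex set, invariant under permutations of the coordinates
and changes of signs, which contains the cube [-1, 1]^n. Rescaling by n^(1/p)
turns the theorem into the search for a norm equivalent to the gauge of L all of
whose shadows have at most a constant times the volume of its unit ball. The
gauge of L itself fails, for instance for the cube, whose shadow along the main
diagonal is about sqrt n times its volume: L has to be rounded off.

The rounding uses the barrier phi u = 1 / (1 - u^2) - 1 on ]-1, 1[. Put
Phi v = sum_i phi (v_i) and body r = L + {v in ]-1, 1[^n | Phi v < r}. Every
such body is convex and symmetric and lies between L and L + ]-1, 1[^n, hence
between L and 2 L, so that its gauge is equivalent to that of L whatever r > 0 is.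
This leaves r free, and the whole point is to choose it well.

Shadows are compared with volumes by sweeping. If S lies well inside W, x is a
unit vector and h is small, translates by multiples of h x of the exit set
{w in W | w + h x notin W} cover long cylinders over the shadow of S, so that h
times the shadow of S is at most 4 times the volume of the exit set ([sweep]).
It is applied to S close to body k, to W = body r for many levels r between
k + 1/2 and k + 1, and to all images g x of x under a group of signed shifts of
the coordinates, which does not change the shadow of S. If z = w + v shows that
z belongs to the first body that contains it, then z exits in the direction g x
only at levels between about Phi v and
Phi (v + h g x) <= Phi v + h <grad Phi v, g x> + O(h^2), and the mean over g of
<y, g x>^2 is |y|^2 / n. Hence the exit sets have on average a volume of at most
3 h times that of body k.+1 plus h / n times the integral of |grad Phi|^2
([exit_count], [exit_measure]).

That integral is controlled by translations alone. If j <= phi (v_l) < j + 1,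
then phi'(v_l)^2 <= 64 * 16^j, and moving the l-th coordinate towards 0 by the
number a_j with phi a_j = j lowers Phi by at least j, because phi is
superadditive; so w + v lies in a translate of body (k.+1 - j). Since all the
bodies lie in one bounded set, k can be chosen such that the volume of body k
divided by 32^k is at least half the supremum of these quotients
([near_maximal_level]). Then body (k.+1 - j) has at most 64 / 32^j times the
volume of body k, the series converges, and neither n nor p enters the bound
([smoothed_unit_ball]).

Of Hausdorff measure, four facts are used: it is an outer measure; similarities
scale it; it is additive on separated sets, so that open sets are measurable in
the sense of Caratheodory; and the unit cube of R^n has a positive and finite
n-dimensional measure. *)

(** * Hausdorff measure as an outer measure *)

Section HausdorffOuterMeasure.
Context {R : realType}.
Local Open Scope ereal_scope.

Section Diameter.
Context {m : nat}.
Implicit Types U V A B : set 'rV[R]_m.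

Lemma le_diam U V : U `<=` V -> diam U <= diam V.
Proof.
move=> UV; apply: ereal_sup_le => _ [x Ux [y Uy <-]] /=.
by exists x; [exact: UV|exists y => //; exact: UV].
Qed.

Lemma diam_set0 : diam (set0 : set 'rV[R]_m) = -oo.
Proof.
rewrite /diam (_ : [set _ | _ in _ & _ in _] = set0) ?ereal_sup0 //.
by rewrite predeqE => z; split => // -[x []].
Qed.

Lemma diam_ge0 U : U !=set0 -> 0 <= diam U.
Proof.
move=> [x Ux]; apply: le_trans (ereal_sup_ubound _); last first.
  by exists x => //; exists x => //.
by rewrite lee_fin sqrtr_ge0.
Qed.

Lemma diam_le U (d : R) :
  (forall x y, U x -> U y -> (euclid_norm (x - y) <= d)%R) -> diam U <= d%:E.
Proof. by move=> Ud; apply: ge_ereal_sup => _ [x Ux [y Uy <-]]; rewrite lee_fin Ud. Qed.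

Lemma euclid_le_diam U (d : R) x y : diam U <= d%:E -> U x -> U y ->
  (euclid_norm (x - y) <= d)%R.
Proof.
move=> Ud Ux Uy; rewrite -lee_fin; apply: le_trans Ud.
by apply: ereal_sup_ubound; exists x => //; exists y.
Qed.

Lemma expe_le (a b : \bar R) s : 0 <= a -> a <= b -> a ^+ s <= b ^+ s.
Proof.
move=> a0 ab; elim: s => [|s ih]; first by rewrite !expe0.
by rewrite !expeS lee_pmul // expe_ge0.
Qed.

Lemma hausdorff_gauge_ge0 s U : 0 <= hausdorff_gauge s U.
Proof.
rewrite /hausdorff_gauge; case: ifPn => // /set0P U0.
by rewrite expe_ge0 // diam_ge0.
Qed.

Lemma hausdorff_gauge0 s : hausdorff_gauge s (set0 : set 'rV[R]_m) = 0.
Proof. by rewrite /hausdorff_gauge eqxx. Qed.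

Lemma hausdorff_gauge_le s U (d : R) : diam U <= d%:E -> U !=set0 -> hausdorff_gauge s U <= (d ^+ s)%:E.
Proof.
move=> Ud U0; rewrite /hausdorff_gauge ifF; last by apply/negbTE/set0P.
by rewrite EFin_expe expe_le // diam_ge0.
Qed.

End Diameter.

(** An alias that carries the sets of diameter at most d as a semiring of sets:
the premeasure at scale d is then the outer extension of the gauge. *)
Definition small_sets (m : nat) (d : R) : Type := 'rV[R]_m.

Section SmallSets.
Context (m : nat) (d : R).

Fact small_sets_display : measure_display. Proof. exact: (default_measure_display). Qed.

Let small : set (set (small_sets m d)) := [set U | @diam R m U <= d%:E].

Let small0 : small set0.
Proof. by rewrite /small /= diam_set0 leNye. Qed.

Let smallI : setI_closed small.
Proof. by move=> U V /= Ud _; apply: le_trans Ud; apply: le_diam => x []. Qed.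

Let smallD : semi_setD_closed small.
Proof.
move=> U V /= Ud _; exists [set U `\` V]; split; rewrite ?bigcup_set1 //.
- by move=> _ ->; apply: le_trans Ud; apply: le_diam => x [].
- by move=> _ _ -> ->.
Qed.

HB.instance Definition _ := Choice.copy (small_sets m d) 'rV[R]_m.
HB.instance Definition _ := isPointed.Build (small_sets m d) (0%R : 'rV[R]_m).
HB.instance Definition _ := isSemiRingOfSets.Build small_sets_display
  (small_sets m d) small0 smallI smallD.

Lemma premeasure_mu_ext s (A : set 'rV[R]_m) :
  hausdorff_premeasure s d A =
  mu_ext (hausdorff_gauge s : set (small_sets m d) -> \bar R) A.
Proof.
rewrite /hausdorff_premeasure /mu_ext; congr ereal_inf; congr image.
by rewrite predeqE => U; split => -[].
Qed.
End SmallSets.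

Section OuterMeasure.
Context (m s : nat).
Notation mu := (@hausdorff_measure R m s).

Lemma le_premeasure d (A B : set 'rV[R]_m) : A `<=` B ->
  hausdorff_premeasure s d A <= hausdorff_premeasure s d B.
Proof. by move=> AB; rewrite !premeasure_mu_ext; apply: le_mu_ext. Qed.

Lemma premeasure_ge0 d (A : set 'rV[R]_m) : 0 <= hausdorff_premeasure s d A.
Proof. by rewrite premeasure_mu_ext; apply: mu_ext_ge0; exact: hausdorff_gauge_ge0. Qed.

Lemma premeasure_sigma_subadditive d (F : (set 'rV[R]_m)^nat) :
  hausdorff_premeasure s d (\bigcup_n F n) <= \sum_(i <oo) hausdorff_premeasure s d (F i).
Proof.
rewrite premeasure_mu_ext; under eq_eseriesr do rewrite premeasure_mu_ext.
by apply: mu_ext_sigma_subadditive => *; exact: hausdorff_gauge_ge0.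
Qed.

Lemma premeasure0 d : hausdorff_premeasure s d (set0 : set 'rV[R]_m) = 0.
Proof.
by rewrite premeasure_mu_ext mu_ext0 // => *; [exact: hausdorff_gauge0|exact: hausdorff_gauge_ge0].
Qed.

HB.instance Definition _ d := isOuterMeasure.Build R 'rV[R]_m
  (@hausdorff_premeasure R m s d)
  (premeasure0 d) (premeasure_ge0 d) (@le_premeasure d) (@premeasure_sigma_subadditive d).

Lemma premeasure_le_hausdorff d (A : set 'rV[R]_m) : (0 < d)%R ->
  hausdorff_premeasure s d A <= mu A.
Proof. by move=> d0; apply: ereal_sup_ubound; exists d. Qed.

Lemma hausdorff_ge0 A : 0 <= mu A.
Proof. exact: le_trans (premeasure_ge0 1 A) (premeasure_le_hausdorff A _). Qed.

Lemma hausdorff_le_premeasure A (x : \bar R) :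
  (forall d : R, (0 < d)%R -> hausdorff_premeasure s d A <= x) -> mu A <= x.
Proof. by move=> H; apply: ge_ereal_sup => _ [d d0 <-]; exact: H. Qed.

Lemma le_hausdorff : {homo mu : A B / A `<=` B >-> A <= B}.
Proof.
move=> A B AB; apply: hausdorff_le_premeasure => d d0.
exact: le_trans (le_premeasure d AB) (premeasure_le_hausdorff B d0).
Qed.

Lemma hausdorff0 : mu set0 = 0.
Proof.
apply/eqP; rewrite eq_le hausdorff_ge0 andbT; apply: hausdorff_le_premeasure => d d0.
by rewrite premeasure0.
Qed.

Lemma hausdorff_sigma_subadditive : sigma_subadditive mu.
Proof.
move=> F; apply: hausdorff_le_premeasure => d d0; apply: le_trans (premeasure_sigma_subadditive d F) _.
apply: lee_nneseries => [*|i _]; first exact: premeasure_ge0.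
exact: premeasure_le_hausdorff.
Qed.

HB.instance Definition _ := isOuterMeasure.Build R 'rV[R]_m mu
  hausdorff0 hausdorff_ge0 le_hausdorff hausdorff_sigma_subadditive.

End OuterMeasure.
End HausdorffOuterMeasure.

(** * Lipschitz maps and separated sets *)

Section HausdorffGeometry.
Context {R : realType}.
Local Open Scope ereal_scope.

(** The pieces U k `&` A, rather than U k, are mapped, since f is controlled on A
only; a cover at scale d / c becomes one at scale d. *)
Lemma hausdorff_lipschitz a b s (f : 'rV[R]_a -> 'rV[R]_b) (c : R) (A : set 'rV[R]_a) :
  (0 < c)%R ->
  (forall x y, A x -> A y -> euclid_norm (f x - f y) <= c * euclid_norm (x - y))%R ->
  hausdorff_measure s (f @` A) <= (c ^+ s)%:E * hausdorff_measure s A.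
Proof.
move=> c0 fc; apply: hausdorff_le_premeasure => d d0.
apply: (@le_trans _ _ ((c ^+ s)%:E * hausdorff_premeasure s (d / c) A)); last first.
  apply: lee_pmul => //; rewrite ?lee_fin ?exprn_ge0 ?premeasure_ge0 ?(ltW c0)//.
  by apply: premeasure_le_hausdorff; rewrite divr_gt0.
rewrite -lee_pdivrMl ?exprn_gt0//.
apply: le_ereal_inf_tmp => _ [U [AU Ud] <-].
rewrite lee_pdivrMl ?exprn_gt0// -nneseriesZl => [|*]; last exact: hausdorff_gauge_ge0.
have fUd k x y : (U k `&` A) x -> (U k `&` A) y ->
    (euclid_norm (f x - f y) <= c * fine (diam (U k)))%R.
  move=> [Ux Ax] [Uy Ay]; apply: le_trans (fc _ _ Ax Ay) _; rewrite ler_pM2l//.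
  apply: (@euclid_le_diam _ _ (U k)) => //; rewrite fineK//.
  rewrite ge0_fin_numE; last by apply: diam_ge0; exists x.
  exact: le_lt_trans (Ud k) (ltry _).
apply: (@le_trans _ _ (\sum_(0 <= k <oo) hausdorff_gauge s (f @` (U k `&` A)))).
  apply: ereal_inf_lbound; exists (fun k => f @` (U k `&` A)) => //; split.
    by move=> _ [x Ax <-]; have [k _ Ukx] := AU x Ax; exists k => //; exists x.
  move=> k; apply: diam_le => _ _ [x [Ux Ax] <-] [y [Uy Ay] <-].
  rewrite (le_trans (fc _ _ Ax Ay))// -ler_pdivlMl// mulrC.
  exact: (euclid_le_diam (Ud k)).
apply: lee_nneseries => [*|k _]; first exact: hausdorff_gauge_ge0.
have [->|/set0P UA0] := eqVneq (U k `&` A) set0.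
  by rewrite image_set0 hausdorff_gauge0 mule_ge0 ?hausdorff_gauge_ge0// lee_fin exprn_ge0// ltW.
have U0 : U k !=set0 by case: UA0 => x [Ux _]; exists x.
apply: (@le_trans _ _ ((c * fine (diam (U k))) ^+ s)%:E).
  apply: hausdorff_gauge_le; last by case: UA0 => x; exists (f x); exists x.
  by apply: diam_le => _ _ [x Ux <-] [y Uy <-]; exact: fUd.
rewrite exprMn EFinM; apply: lee_pmul => //.
- by rewrite lee_fin exprn_ge0 // ltW.
- by rewrite lee_fin exprn_ge0 // fine_ge0 // diam_ge0.
- rewrite EFin_expe fineK; last first.
    by rewrite ge0_fin_numE ?diam_ge0 // (le_lt_trans (Ud k))// ltry.
  by rewrite /hausdorff_gauge ifF //; apply/negbTE/set0P.
Qed.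

Lemma euclid_eq0 m (x : 'rV[R]_m) : euclid_norm x = 0%R -> x = 0%R.
Proof.
have ge0 (i : 'I_m) : (0 <= x ord0 i * x ord0 i)%R by rewrite -expr2 sqr_ge0.
move/eqP; rewrite sqrtr_eq0 => xx; apply/rowP => i; rewrite mxE.
have /(psumr_eq0P (fun i _ => ge0 i)) : (\sum_(i < m) x ord0 i * x ord0 i = 0)%R.
  by apply/eqP; rewrite eq_le xx sumr_ge0.
by move=> /(_ i isT) /eqP; rewrite mulf_eq0 orbb => /eqP.
Qed.

(** The inverse of a similarity on its image is Lipschitz with constant c^-1. *)
Lemma hausdorff_similarity a b s (f : 'rV[R]_a -> 'rV[R]_b) (c : R) (A : set 'rV[R]_a) :
  (0 < c)%R ->
  (forall x y, A x -> A y -> euclid_norm (f x - f y) = c * euclid_norm (x - y))%R ->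
  hausdorff_measure s (f @` A) = (c ^+ s)%:E * hausdorff_measure s A.
Proof.
move=> c0 fc; apply/eqP; rewrite eq_le; apply/andP; split.
  by apply: hausdorff_lipschitz => // x y Ax Ay; rewrite fc.
pose g y := xget 0%R [set x | A x /\ f x = y].
have gK x : A x -> g (f x) = x.
  move=> Ax; have [Ag fg] : A (g (f x)) /\ f (g (f x)) = f x.
    by apply: (@xgetPex _ 0%R [set z | A z /\ f z = f x]); exists x.
  apply/eqP; rewrite -subr_eq0; apply/eqP/euclid_eq0.
  have /eqP := fc _ _ Ag Ax; rewrite fg subrr.
  have -> : euclid_norm (0 : 'rV[R]_b)%R = 0%R.
    by rewrite /euclid_norm /dotp big1 ?sqrtr0// => i _; rewrite mxE mul0r.
  by rewrite eq_sym mulf_eq0 (gt_eqF c0) => /eqP.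
have {1}-> : A = g @` (f @` A).
  rewrite predeqE => x; split => [Ax|[_ [y Ay <-] <-]]; last by rewrite gK.
  by exists (f x); [exists x|rewrite gK].
rewrite -lee_pdivlMl ?exprn_gt0// -exprVn; apply: hausdorff_lipschitz.
  by rewrite invr_gt0.
move=> _ _ [x Ax <-] [y Ay <-]; rewrite !gK// fc// mulrA mulVf ?mul1r//.
by rewrite gt_eqF.
Qed.

(** A set of diameter less than d cannot meet both A and B, so that each member of
a fine cover of the union serves only one of the two. *)
Lemma premeasure_separated m s (A B : set 'rV[R]_m) (d d1 d2 : R) :
  (d1 < d)%R -> (d2 < d)%R ->
  (forall x y, A x -> B y -> (d <= euclid_norm (x - y))%R) ->
  hausdorff_premeasure s d1 A + hausdorff_premeasure s d2 B <=
  hausdorff_premeasure s (Num.min d1 d2) (A `|` B).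
Proof.
move=> d1d d2d sepAB; apply: le_ereal_inf_tmp => _ [U [ABU Ud] <-].
pose part (C : set 'rV[R]_m) k := [set x | U k x /\ (U k `&` C) !=set0].
have partE C k : part C k = U k \/ part C k = set0.
  have [UC|nUC] := pselect ((U k `&` C) !=set0); [left|right].
    by rewrite predeqE => x; split => [[]|].
  by rewrite predeqE => x; split => [[]|].
have cover C d' : C `<=` \bigcup_k U k -> (Num.min d1 d2 <= d')%R ->
    hausdorff_premeasure s d' C <= \sum_(0 <= k <oo) hausdorff_gauge s (part C k).
  move=> CU dd'; apply: ereal_inf_lbound; exists (part C) => //; split.
    by move=> x Cx; have [k _ Ukx] := CU x Cx; exists k => //; split => //; exists x.
  move=> k; apply: (@le_trans _ _ (diam (U k))); first by apply: le_diam => x [].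
  by rewrite (le_trans (Ud k))// lee_fin.
apply: (@le_trans _ _ (\sum_(0 <= k <oo) hausdorff_gauge s (part A k) +
                      \sum_(0 <= k <oo) hausdorff_gauge s (part B k))).
  apply: leeD; apply: cover; rewrite ?ge_min ?lexx ?orbT//.
  - by move=> x Ax; apply: ABU; left.
  - by move=> x Bx; apply: ABU; right.
rewrite -nneseriesD => [|*|*]; try exact: hausdorff_gauge_ge0.
apply: lee_nneseries => [*|k _]; first by rewrite adde_ge0 // hausdorff_gauge_ge0.
have [partA|->] := partE A k; last first.
  by rewrite hausdorff_gauge0 add0e; have [->|->] := partE B k; rewrite ?hausdorff_gauge0 ?hausdorff_gauge_ge0.
have [partB|->] := partE B k; last by rewrite hausdorff_gauge0 adde0 partA.
have [->|/set0P[z Uz]] := eqVneq (part A k) set0; first by rewrite hausdorff_gauge0 add0e partB.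
have [_ [x [Ux Ax]]] := Uz.
have [->|/set0P[z' Uz']] := eqVneq (part B k) set0; first by rewrite hausdorff_gauge0 adde0 partA.
have [_ [y [Uy By]]] := Uz'.
have := euclid_le_diam (Ud k) Ux Uy; rewrite leNgt => /negP[].
by apply: lt_le_trans (sepAB _ _ Ax By); rewrite gt_min d1d.
Qed.

Lemma hausdorff_separated m s (A B : set 'rV[R]_m) (d : R) : (0 < d)%R ->
  (forall x y, A x -> B y -> (d <= euclid_norm (x - y))%R) ->
  hausdorff_measure s A + hausdorff_measure s B <= hausdorff_measure s (A `|` B).
Proof.
move=> d0 sepAB; set S := hausdorff_measure s (A `|` B).
have [->|Soo] := eqVneq S +oo; first by rewrite leey.
have fin (x : \bar R) : 0 <= x -> x <= S -> x \is a fin_num.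
  move=> x0 xS; rewrite ge0_fin_numE//; apply: le_lt_trans xS _.
  by rewrite ltey.
have finA : hausdorff_measure s A \is a fin_num.
  by apply: fin; [exact: hausdorff_ge0|apply: le_hausdorff => x; left].
have antitone d1 d2 (C : set 'rV[R]_m) : (d1 <= d2)%R ->
    hausdorff_premeasure s d2 C <= hausdorff_premeasure s d1 C.
  move=> d12; apply: ereal_inf_le_tmp => _ [U [CU Ud] <-].
  by exists U => //; split => // k; rewrite (le_trans (Ud k))// lee_fin.
have dmin e : (0 < e)%R -> (0 < Num.min e (d / 2))%R /\ (Num.min e (d / 2) < d)%R.
  move=> e0; rewrite lt_min e0 divr_gt0//; split => //.
  by rewrite gt_min ltr_pdivrMr// ltr_pMr// ltr1n orbT.
have main d1 d2 : (0 < d1)%R -> (0 < d2)%R ->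
    hausdorff_premeasure s d1 A + hausdorff_premeasure s d2 B <= S.
  move=> /dmin[d10 d1d] /dmin[d20 d2d].
  apply: (@le_trans _ _ (hausdorff_premeasure s (Num.min d1 (d/2))%R A +
                        hausdorff_premeasure s (Num.min d2 (d/2))%R B)).
    by apply: leeD; apply: antitone; rewrite ge_min lexx.
  apply: le_trans (premeasure_separated s d1d d2d sepAB) _.
  by apply: premeasure_le_hausdorff; rewrite lt_min d10.
rewrite addeC -leeBrDr//; apply: hausdorff_le_premeasure => d2 d20.
rewrite leeBrDr// addeC.
have finB : hausdorff_premeasure s d2 B \is a fin_num.
  apply: fin; first exact: premeasure_ge0.
  apply: le_trans (premeasure_le_hausdorff s B d20) _.
  by apply: le_hausdorff => x; right.
by rewrite -leeBrDr//; apply: hausdorff_le_premeasure => d1 d10; rewrite leeBrDr// main.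
Qed.

End HausdorffGeometry.

(** * The unit cube has positive measure *)

Section UnitCube.
Context {R : realType}.
Local Open Scope ereal_scope.

Definition box n (a : 'rV[R]_n) (d : R) : set 'rV[R]_n :=
  [set x | forall i, (a 0%R i <= x 0%R i <= a 0%R i + d)%R].

(** By induction on n: for each value y of the first coordinate the slices of the
boxes cover a cube of dimension one less, and integrating this inequality over y
in [0, 1] produces the missing factor d k. The weights c k are there to absorb
the indicators of y. *)
Lemma box_cover n (c d : nat -> R) (a : nat -> 'rV[R]_n) :
  (forall k, 0 <= c k)%R -> (forall k, 0 <= d k)%R ->
  (forall x, unit_cube x -> 1 <= \sum_(0 <= k <oo) (c k * \1_(box (a k) (d k)) x)%:E) ->
  1 <= \sum_(0 <= k <oo) (c k * d k ^+ n)%:E.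
Proof.
elim: n c a => [|n ih] c a c0 d0 cov.
  apply: le_trans (cov 0%R _) _; first by case.
  apply: lee_nneseries => [k _ _|k _]; first by rewrite lee_fin mulr_ge0.
  by rewrite lee_fin expr0 ler_wpM2l// indicE; case: (_ \in _).
pose I k : set R := [set` `[a k 0%R ord0, a k 0%R ord0 + d k]%R].
pose a' k : 'rV[R]_n := \row_j a k 0%R (lift ord0 j).
have slice (y : R) : (0 <= y <= 1)%R ->
    1 <= \sum_(0 <= k <oo) (c k * d k ^+ n * \1_(I k) y)%:E.
  move=> y01; have := ih (fun k => c k * \1_(I k) y)%R a' _ d0 _.
  under eq_eseriesr do rewrite mulrAC; apply.
    by move=> k; rewrite mulr_ge0.
  move=> x x01.
  pose z : 'rV[R]_n.+1 := \row_i (if unlift ord0 i is Some j then x 0%R j else y).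
  have z01 : unit_cube z.
    by move=> i; rewrite mxE; case: unliftP => [j _|_]; [exact: x01|].
  apply: le_trans (cov _ z01) _.
  apply: lee_nneseries => [k _ _|k _]; first by rewrite lee_fin mulr_ge0.
  rewrite lee_fin -mulrA ler_wpM2l// !indicE.
  case: (boolP (z \in box (a k) (d k))) => [/set_mem zb|_]; last by rewrite mulr_ge0.
  rewrite !mem_set ?mulr1//.
    by move=> j; have := zb (lift ord0 j); rewrite !mxE liftK.
  by have := zb ord0; rewrite mxE unlift_none /I /= in_itv.
pose D : set R := [set` `[0%R, 1%R]%R].
have mI k : measurable (I k) by exact: measurable_itv.
have mD : measurable D by exact: measurable_itv.
pose f k : R -> \bar R := fun y => (c k * d k ^+ n * \1_(I k) y)%:E.
have mf k : measurable_fun D (f k).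
  by apply/measurable_EFinP; apply: measurable_funM => //; exact: measurable_indic.
have f0 k y : D y -> 0 <= f k y.
  by move=> _; rewrite lee_fin !mulr_ge0// exprn_ge0.
have : \int[lebesgue_measure]_(y in D) 1 <=
    \int[lebesgue_measure]_(y in D) \sum_(0 <= k <oo) f k y.
  apply: ge0_le_integral => //.
  exact: (@ge0_emeasurable_sum _ _ R D f xpredT (fun k y Dy _ => f0 k y Dy) (fun k _ => mf k)).
  
rewrite integral_cst// mul1e.
have muD : lebesgue_measure D = 1 by rewrite lebesgue_measure_itv /= lte_fin ltr01 sube0.
rewrite [X in X <= _]muD.
move/le_trans; apply; rewrite integral_nneseries//.
apply: lee_nneseries => [k _ _|k _]; first by apply: integral_ge0 => y; exact: f0.
under eq_integral do rewrite /f EFinM.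
rewrite ge0_integralZl//; last first.
- by rewrite lee_fin mulr_ge0// exprn_ge0.
- by apply/measurable_EFinP; apply: measurable_indic; exact: mI.
rewrite integral_indic //; last exact: mI.
rewrite exprSr mulrA [leRHS]EFinM.
apply: lee_pmul; [by rewrite lee_fin !mulr_ge0 // exprn_ge0|exact: measure_ge0|by []|].
apply: (@le_trans _ _ (lebesgue_measure (I k))).
  apply: le_measure; [apply: mem_set; apply: measurableI; [exact: mI|exact: mD]|apply: mem_set; exact: mI|by move=> y []].
have : lebesgue_measure (I k) <= (d k)%:E; last by [].
rewrite lebesgue_measure_itv /= lte_fin; case: ifPn => _; last by rewrite lee_fin.
by rewrite -EFinB lee_fin addrC addKr.
Qed.

Lemma coord_le_euclid n (x : 'rV[R]_n) i : (`|x 0 i| <= euclid_norm x)%R.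
Proof.
rewrite /euclid_norm -ler_sqr ?nnegrE ?sqrtr_ge0// real_normK ?num_real//.
rewrite sqr_sqrtr; last by apply: sumr_ge0 => j _; rewrite -expr2 sqr_ge0.
rewrite /dotp (bigD1 i)//= -expr2 lerDl.
by apply: sumr_ge0 => j _; rewrite -expr2 sqr_ge0.
Qed.

Lemma euclid_le_coord n (x : 'rV[R]_n) (r : R) : (0 <= r)%R ->
  (forall i, `|x 0 i| <= r)%R -> (euclid_norm x <= n%:R * r)%R.
Proof.
move=> r0 xr; rewrite -[leRHS]ger0_norm ?mulr_ge0// -sqrtr_sqr ler_wsqrtr//.
apply: (@le_trans _ _ (\sum_(i < n) r ^+ 2)%R).
  apply: ler_sum => i _; rewrite -expr2 -real_normK ?num_real//.
  by rewrite ler_sqr ?nnegrE.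
rewrite sumr_const card_ord exprMn -[leLHS]mulr_natl.
apply: ler_wpM2r; first exact: sqr_ge0.
by rewrite -natrX ler_nat; case: (n) => // k; rewrite expnS leq_pmulr// expn_gt0.
Qed.

(** A set of diameter e is contained in a box of side 2 e. *)
Lemma unit_cube_gt0 n : 0 < hausdorff_measure n (@unit_cube R n).
Proof.
apply: (@lt_le_trans _ _ (((2 ^+ n)^-1)%R%:E)); first by rewrite lte_fin invr_gt0 exprn_gt0.
apply: le_trans (premeasure_le_hausdorff n _ ltr01).
apply: le_ereal_inf_tmp => _ [U [QU U1] <-].
rewrite -[leLHS]mule1 lee_pdivrMl ?exprn_gt0//.
have Ufin k : U k !=set0 -> diam (U k) \is a fin_num.
  by move=> U0; rewrite ge0_fin_numE ?diam_ge0// (le_lt_trans (U1 k))// ltry.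
pose e k := fine (diam (U k)).
pose c k : R := (U k != set0)%:R.
pose d k : R := (c k * (2 * e k))%R.
have e0 k : U k !=set0 -> (0 <= e k)%R by move=> U0; rewrite fine_ge0// diam_ge0.
(* u k is some point of U k; an empty U k has weight 0, so that its box is
   harmless. *)
pose u k : 'rV[R]_n := xget 0%R (U k).
pose a k : 'rV[R]_n := \row_j (u k 0 j - e k)%R.
have := @box_cover n c d a _ _ _.
have -> : \sum_(0 <= k <oo) (c k * d k ^+ n)%:E =
          (2 ^+ n)%:E * \sum_(0 <= k <oo) hausdorff_gauge n (U k).
  rewrite -nneseriesZl => [|*]; last exact: hausdorff_gauge_ge0.
  apply: eq_eseriesr => k _; rewrite /d /c /hausdorff_gauge.
  case: eqVneq => [_|/set0P U0]; first by rewrite mul0r mule0.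
  by rewrite !mul1r -(fineK (Ufin _ U0)) -EFin_expe -EFinM -exprMn.
apply.
- by move=> k; rewrite /c.
- move=> k; rewrite /d /c; case: eqVneq => [_|/set0P U0]; first by rewrite mul0r.
  by rewrite mul1r mulr_ge0// e0.
- move=> x /QU[k _ Ukx].
  have U0 : U k !=set0 by exists x.
  have t0 j : 0 <= (c j * \1_(box (a j) (d j)) x)%:E by rewrite lee_fin mulr_ge0.
  have tk : (c k * \1_(box (a k) (d k)) x)%:E = 1.
    rewrite /c; case: eqVneq U0 => [->[]//|_ U0]; rewrite mul1r indicE mem_set//.
    move=> i; rewrite /a mxE /d /c; case: eqVneq U0 => [->[]//|_ U0]; rewrite mul1r.
    have Uu : U k (u k) by apply: xgetPex; exists x.
    have : (`|(x - u k) 0 i| <= e k)%R.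
      apply: le_trans (coord_le_euclid _ _) _.
      by apply: (@euclid_le_diam _ _ (U k)); rewrite ?fineK// Ufin.
    rewrite !mxE ler_norml => /andP[h1 h2]; apply/andP; split; lra.
  rewrite (nneseries_split _ k.+1)// big_mkord big_ord_recr /= tk -addeA.
  rewrite addeCA leeDl// adde_ge0//; first by rewrite sume_ge0.
  exact: nneseries_ge0.
Qed.

End UnitCube.

(** * Cubes and finiteness *)

Section OuterMeasureFinite.
Context {R : realType} {T : Type}.
Local Open Scope ereal_scope.

Lemma outer_measure_bigU (mu : {outer_measure set T -> \bar R}) (I : Type) (r : seq I)
    (F : I -> set T) :
  mu (\big[setU/set0]_(i <- r) F i) <= \sum_(i <- r) mu (F i).
Proof.
elim: r => [|i r ih]; first by rewrite !big_nil outer_measure0.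
by rewrite !big_cons; apply: le_trans (outer_measureU2 mu _ _) _; rewrite leeD2l.
Qed.

Lemma outer_measure_fin_cover (mu : {outer_measure set T -> \bar R}) (I : finType)
    (A : set T) (J : pred I) (F : I -> set T) :
  (forall x, A x -> exists2 i, J i & F i x) -> mu A <= \sum_(i | J i) mu (F i).
Proof.
move=> AF; rewrite -big_filter.
apply: le_trans (outer_measure_bigU mu _ F); apply: le_outer_measure => x /AF[i Ji Fix].
rewrite -bigcup_seq; exists i => //=.
by rewrite mem_filter; apply/andP; split=> //; rewrite mem_index_enum.
Qed.

End OuterMeasureFinite.

Section Cubes.
Context {R : realType}.
Local Open Scope ereal_scope.

Lemma euclid_normZ n (a : R) (x : 'rV[R]_n) :
  euclid_norm (a *: x) = (`|a| * euclid_norm x)%R.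
Proof.
rewrite /euclid_norm -sqrtr_sqr -sqrtrM ?sqr_ge0//; congr Num.sqrt.
by rewrite /dotp mulr_sumr; apply: eq_bigr => i _; rewrite !mxE; ring.
Qed.

Lemma hausdorff_homothety n s (c : R) (v : 'rV[R]_n) A : (0 < c)%R ->
  hausdorff_measure s ((fun x => c *: x + v)%R @` A) = (c ^+ s)%:E * hausdorff_measure s A.
Proof.
move=> c0; apply: hausdorff_similarity => // x y _ _.
by rewrite opprD addrACA subrr addr0 -scalerBr euclid_normZ gtr0_norm.
Qed.

Lemma hausdorff_translate n s (v : 'rV[R]_n) A :
  hausdorff_measure s ((fun x => x + v)%R @` A) = hausdorff_measure s A.
Proof.
rewrite (@hausdorff_similarity _ _ _ _ _ 1)// ?expr1n ?mul1e// => x y _ _.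
by rewrite opprD addrACA subrr addr0 mul1r.
Qed.

Lemma box_measure n (a : 'rV[R]_n) (r : R) : (0 < r)%R ->
  hausdorff_measure n (box a r) = (r ^+ n)%:E * hausdorff_measure n (@unit_cube R n).
Proof.
move=> r0; rewrite -(hausdorff_homothety _ a)//; congr hausdorff_measure.
rewrite predeqE => x; split => [xa|[y y01 <-] i]; last first.
  rewrite !mxE; have /andP[y0 y1] := y01 i.
  apply/andP; split; [rewrite lerDr mulr_ge0// ltW//|].
  by rewrite addrC lerD2l ger_pMr.
exists (r^-1 *: (x - a))%R; last by rewrite scalerA divff ?gt_eqF// scale1r subrK.
move=> i; rewrite !mxE; have /andP[xa1 xa2] := xa i.
rewrite mulr_ge0 ?invr_ge0 ?(ltW r0) ?subr_ge0//= ler_pdivrMl// mulr1.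
by rewrite lerBlDl.
Qed.

Definition cell n N (o e : R) (f : {ffun 'I_n -> 'I_N}) : 'rV[R]_n :=
  \row_i (o + (f i)%:R * e)%R.

Lemma cell_cover n N (o e : R) (x : 'rV[R]_n) : (0 < e)%R ->
  (forall i, o <= x 0%R i < o + N%:R * e)%R ->
  exists f : {ffun 'I_n -> 'I_N}, box (cell o e f) e x.
Proof.
move=> e0 xo.
have lt i : (Num.truncn ((x 0%R i - o) / e) < N)%N.
  rewrite truncn_lt_nat; last by have /andP[h _] := xo i; rewrite divr_ge0 ?subr_ge0 ?(ltW e0).
  by rewrite ltr_pdivrMr// ltrBlDl; have /andP[] := xo i.
exists [ffun i => Ordinal (lt i)] => i; rewrite mxE ffunE /=.
have /andP[h _] := xo i.
have q0 : (0 <= (x 0%R i - o) / e)%R by rewrite divr_ge0 ?subr_ge0 ?(ltW e0).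
have /andP[t1 t2] := truncn_itv q0; move: t1 t2.
set t := Num.truncn _; rewrite ler_pdivlMr// ltr_pdivrMr// => t1.
rewrite -natr1 mulrDl mul1r => t2.
apply/andP; split; lra.
Qed.

Lemma box_diam n (a : 'rV[R]_n) (e : R) : (0 <= e)%R -> diam (box a e) <= (n%:R * e)%:E.
Proof.
move=> e0; apply: diam_le => x y xa ya; apply: euclid_le_coord => // i.
have := xa i; have := ya i; rewrite !mxE ler_norml => /andP[y1 y2] /andP[x1 x2].
apply/andP; split; lra.
Qed.

(** The cube is covered by (N + 1)^n cells of side 1 / N; index ranges are half-open,
and the last layer catches the faces at 1. *)
Lemma unit_cube_fin n : hausdorff_measure n (@unit_cube R n) < +oo.
Proof.
apply: (@le_lt_trans _ _ ((2 * n%:R) ^+ n)%:E); last exact: ltry.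
apply: hausdorff_le_premeasure => d d0.
pose N := (Num.truncn (n%:R / d)).+1.
have N0 : (0 < N%:R :> R)%R by [].
pose e : R := (N%:R^-1)%R.
have e0 : (0 < e)%R by rewrite invr_gt0.
have ned : (n%:R * e <= d)%R.
  rewrite ler_pdivrMr// mulrC -ler_pdivrMr//; apply: ltW; exact: truncnS_gt.
apply: (@le_trans _ _ (\sum_(f : {ffun 'I_n -> 'I_(N.+1)})
   hausdorff_premeasure n d (box (cell 0%R e f) e))).
  apply: outer_measure_fin_cover => x x01.
  have [|f xf] := @cell_cover n N.+1 0%R e x e0; last by exists f.
  move=> i; have /andP[x0 x1] := x01 i; rewrite x0 add0r (le_lt_trans x1)//.
  by rewrite ltr_pdivlMr// mul1r ltr_nat.
apply: (@le_trans _ _ (\sum_(f : {ffun 'I_n -> 'I_(N.+1)}) ((n%:R * e) ^+ n)%:E)).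
  apply: lee_sum => f _.
  have fd := box_diam (cell 0%R e f) (ltW e0).
  apply: (@le_trans _ _ (hausdorff_gauge n (box (cell 0%R e f) e))); last first.
    apply: hausdorff_gauge_le => //; exists (cell 0%R e f) => i.
    by rewrite lexx /= lerDl ltW.
  apply: ereal_inf_lbound.
  exists (fun k : nat => if k == 0%N then box (cell 0%R e f) e else set0).
    split => [x xb|[|k]]; first by exists 0%N.
      by apply: le_trans fd _; rewrite lee_fin.
    by rewrite diam_set0 leNye.
  rewrite (nneseries_split _ 1) => [|*]; last exact: hausdorff_gauge_ge0.
  rewrite big_mkord big_ord1 eseries0 ?adde0// => -[|k]// _ _.
  exact: hausdorff_gauge0.
rewrite sumEFin lee_fin sumr_const card_ffun !card_ord -[leLHS]mulr_natl natrX.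
rewrite -exprMn; apply: lerXn2r; rewrite ?nnegrE ?mulr_ge0// ?(ltW e0)//.
rewrite mulrCA mulrC ler_wpM2r// ler_pdivrMr// -natrM ler_nat mul2n -addnn.
by rewrite -addn1 leq_add2l.
Qed.

Lemma hausdorff_bounded_fin n (A : set 'rV[R]_n) (D : R) :
  (forall x i, A x -> `|x 0%R i| <= D)%R -> hausdorff_measure n A < +oo.
Proof.
move=> AD; pose r : R := (1 + 2 * `|D|)%R.
have r0 : (0 < r)%R by rewrite ltr_pwDl// mulr_ge0.
apply: (@le_lt_trans _ _ (hausdorff_measure n (box (const_mx (- `|D|)%R : 'rV[R]_n) r))).
  apply: le_hausdorff => x Ax i; rewrite !mxE.
  have := AD x i Ax; rewrite ler_norml => /andP[x1 x2].
  have := ler_norm D; rewrite /r => ?; apply/andP; split; lra.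
rewrite box_measure//; apply: lte_mul_pinfty => //.
- by rewrite lee_fin exprn_ge0// ltW.
- exact: unit_cube_fin.
Qed.

End Cubes.

(** * Measurability of open sets *)

Lemma sum_parity (R : numDomainType) (f : nat -> \bar R) N :
  (\sum_(0 <= k < N.*2) f k =
   \sum_(0 <= k < N) f (k.*2 + 0)%N + \sum_(0 <= k < N) f (k.*2 + 1)%N)%E.
Proof.
elim: N => [|N ih]; first by rewrite !big_geq// adde0.
by rewrite doubleS !big_nat_recr//= ih addn0 addn1 -addeA addeACA.
Qed.

Section Separated.
Context {R : realType} {n : nat}.
Local Open Scope ereal_scope.
Implicit Types (A B G X : set 'rV[R]_n) (x y z : 'rV[R]_n).

(** Some coordinate differs by at least d: a lower bound for the Euclidean distance. *)
Definition separated A B := exists2 d : R, (0 < d)%R &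
  forall x y, A x -> B y -> exists i, (d <= `|x 0 i - y 0 i|)%R.

Lemma separated_euclid A B : separated A B -> exists2 d : R, (0 < d)%R &
  forall x y, A x -> B y -> (d <= euclid_norm (x - y))%R.
Proof.
move=> [d d0 AB]; exists d => // x y Ax By; have [i di] := AB x y Ax By.
by apply: le_trans (coord_le_euclid _ i); rewrite !mxE.
Qed.

Lemma hausdorff_separatedU s A B : separated A B ->
  hausdorff_measure s A + hausdorff_measure s B <= hausdorff_measure s (A `|` B).
Proof. by move=> /separated_euclid[d d0 AB]; exact: hausdorff_separated AB. Qed.

Lemma hausdorff_separated_seq s (I : eqType) (r : seq I) (F : I -> set 'rV[R]_n) :
  uniq r -> (forall i j, i != j -> separated (F i) (F j)) ->
  \sum_(i <- r) hausdorff_measure s (F i) <= hausdorff_measure s (\big[setU/set0]_(i <- r) F i).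
Proof.
move=> + sep; elim: r => [|i r ih] /=; first by rewrite !big_nil hausdorff_ge0.
move=> /andP[ir ur]; rewrite !big_cons.
apply: le_trans (hausdorff_separatedU s _); first by rewrite leeD2l// ih.
elim: r ir {ih ur} => [_|j r ih]; first by exists 1%R => // x y _; rewrite big_nil.
rewrite inE negb_or => /andP[ij /ih[d d0 Fd]].
have [e e0 Fe] := sep i j ij; exists (Num.min d e); first by rewrite lt_min d0.
move=> x y Fx; rewrite big_cons => -[Fy|Fy].
  by have [k] := Fe x y Fx Fy; exists k; rewrite ge_min; apply/orP; right.
by have [k] := Fd x y Fx Fy; exists k; rewrite ge_min; apply/orP; left.
Qed.

Definition sup_open G := forall x, G x ->
  exists2 e : R, (0 < e)%R & forall y, (forall i, `|y 0 i - x 0 i| < e)%R -> G y.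

(** The classical criterion of Caratheodory for metric outer measures. The points
Gk k of depth at least 1 / (k + 1) in G are separated from the complement of G,
and the layers D k between consecutive depths are separated from each other as
soon as their indices differ by at least 2; so the measures of the layers have
a finite sum, and X `&` Gk k exhausts X `&` G in measure. *)
Lemma sup_open_caratheodory s G : sup_open G ->
  (@hausdorff_measure R n s).-caratheodory G.
Proof.
move=> oG; apply: le_caratheodory_measurable => X.
pose mu := @hausdorff_measure R n s.
suff : mu (X `&` G) + mu (X `&` ~` G) <= mu X by [].

have [->|Xoo] := eqVneq (mu X) +oo; first by rewrite leey.
have Xfin : mu X < +oo by rewrite ltey.
pose Gk (k : nat) := [set x : 'rV[R]_n | forall y : 'rV[R]_n, (forall i, `|y 0 i - x 0 i| < k.+1%:R^-1)%R -> G y].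
have GkS k l : (k <= l)%N -> Gk k `<=` Gk l.
  move=> kl x xk y yx; apply: xk => i; apply: lt_le_trans (yx i) _.
  by rewrite lef_pV2 ?posrE// ler_nat.
have notP x y k : Gk k x -> ~ G y -> exists i, (k.+1%:R^-1 <= `|y 0 i - x 0 i|)%R.
  move=> xk nGy; apply: contrapT => /forallNP nx; apply: nGy; apply: xk => i.
  by rewrite ltNge; apply/negP; exact: nx.
pose D k := X `&` (Gk k.+1 `\` Gk k).
have sepD j k : (j.+2 <= k)%N -> separated (D j) (D k).
  move=> jk; exists (j.+2%:R^-1 - j.+3%:R^-1)%R.
    by rewrite subr_gt0 ltf_pV2 ?posrE// ltr_nat.
  move=> x y [_ [xj _]] [_ [_ yk]].
  have [z [zy nGz]] : exists z : 'rV[R]_n, (forall i, `|z 0 i - y 0 i| < k.+1%:R^-1)%R /\ ~ G z.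
    apply: contrapT => /forallNP H; apply: yk => z zy.
    by apply: contrapT => nGz; apply: (H z).
  have [i zi] := notP x z _ xj nGz; exists i.
  have h : (k.+1%:R^-1 <= j.+3%:R^-1 :> R)%R by rewrite lef_pV2 ?posrE// ler_nat.
  have zyi := zy i; have : (`|z 0 i - x 0 i| <= `|z 0 i - y 0 i| + `|x 0 i - y 0 i|)%R.
    by rewrite (distrC (x 0%R i)); apply: ler_distD.
  move: zi h zyi; move: (j.+2%:R^-1)%R (j.+3%:R^-1)%R (k.+1%:R^-1)%R => a b c *.
  lra.
have sepC A B : separated A B -> separated B A.
  by move=> [d d0 AB]; exists d => // x y Bx Ay; have [i] := AB y x Ay Bx; exists i; rewrite distrC.
(* Layers with indices of equal parity are pairwise separated. *)
have half (a : nat) N : (\sum_(0 <= k < N) mu (D (k.*2 + a)%N)) <= mu X.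
  have := @hausdorff_separated_seq s _ (index_iota 0 N) (fun k => D (k.*2 + a)%N) (iota_uniq _ _).
  move=> /(_ _)/le_trans; apply.
    move=> i j; rewrite neq_ltn => /orP[ij|ji]; [|apply: sepC].
      by apply: sepD; rewrite -addSn -addSn leq_add2r -doubleS leq_double.
    by apply: sepD; rewrite -addSn -addSn leq_add2r -doubleS leq_double.
  apply: le_hausdorff; elim/big_ind: _ => // [A B AX BX|k _]; last by move=> x [].
  by move=> x [/AX|/BX].
have total : \sum_(0 <= k <oo) mu (D k) <= mu X + mu X.
  apply: lime_le; first by apply: is_cvg_nneseries => *; exact: hausdorff_ge0.
  apply: nearW => N.
  apply: (@le_trans _ _ (\sum_(0 <= k < N.*2) mu (D k))).
    rewrite (@big_cat_nat _ _ _ N 0 N.*2)//=; last by rewrite -addnn leq_addr.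
    by rewrite leeDl// sume_ge0// => *; exact: hausdorff_ge0.
  apply: le_trans (leeD (half 0%N N) (half 1%N N)).
  by rewrite sum_parity.
have tail : (fun N => \sum_(N <= k <oo) mu (D k)) @ \oo --> 0.
  apply: nneseries_tail_cvg => [|*]; last exact: hausdorff_ge0.
  by apply: (le_lt_trans total); rewrite lte_add_pinfty.
have step N : mu (X `&` G) + mu (X `&` ~` G) <= mu X + \sum_(N <= k <oo) mu (D k).
  apply: (@le_trans _ _ (mu (X `&` Gk N) + mu (\bigcup_(k in ~` `I_N) D k) + mu (X `&` ~` G))).
    rewrite leeD2r//; apply: le_trans (outer_measureU2 _ _ _).
    apply: le_hausdorff => x [Xx Gx].
    have [xN|xN] := pselect (Gk N x); [by left|right].
    have [e e0 xe] := oG x Gx.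
    pose M := Num.truncn (e^-1)%R.
    have xM : Gk M x.
      move=> y yx; apply: xe => i; apply: lt_trans (yx i) _.
      by rewrite invf_plt ?posrE// truncnS_gt.
    have exG : exists k, `[< Gk k x >] by exists M; apply/asboolP.
    case: (ex_minnP exG) => -[|k] /asboolP xk kmin.
      by exfalso; apply: xN; apply: GkS xk.
    exists k => /=.
      by move=> kN; apply: xN; apply: GkS xk.
    split => //; split => // xk'.
    by have := kmin k; rewrite ltnn => /(_ _)/negP; apply => //; apply/asboolP.
  rewrite -addeAC; apply: leeD.
    apply: le_trans (hausdorff_separatedU s _) _.
      exists N.+1%:R^-1%R => // x y [_ xN] [_ nGy].
      by have [i] := notP x y N xN nGy; exists i; rewrite distrC.
    by apply: le_hausdorff => x [[]|[]].
  exact: outer_measure_sigma_subadditive_tail.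
apply/lee_addgt0Pr => e e0.
have /fine_cvgP[_ /cvgrPdist_lt/(_ e e0)[N _ /(_ N (leqnn N)) /=]] := tail.
rewrite sub0r normrN => tN; apply: le_trans (step N) _; rewrite leeD2l//.
have tail_ge0 : 0 <= \sum_(N <= k <oo) mu (D k).
  by apply: nneseries_ge0 => *; exact: hausdorff_ge0.
have tail_fin : \sum_(N <= k <oo) mu (D k) \is a fin_num.
  rewrite ge0_fin_numE//; apply: le_lt_trans (_ : mu X + mu X < +oo); last first.
    by rewrite lte_add_pinfty.
  apply: le_trans total; rewrite (nneseries_split 0 N) ?add0n => [|*]; last exact: hausdorff_ge0.
  by rewrite leeDr// sume_ge0// => *; exact: hausdorff_ge0.
rewrite -(fineK tail_fin) lee_fin; apply: ltW; apply: le_lt_trans tN.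
exact: ler_norm.
Qed.

End Separated.

(** * Real-valued measure of bounded sets *)

Section RealMeasure.
Context {R : realType}.

(** Meaningful only where the Hausdorff measure is finite, in particular on bounded
sets when s is the dimension of the space. *)
Definition hmeas {m} (s : nat) (A : set 'rV[R]_m) : R := fine (hausdorff_measure s A).
Definition kappa (n : nat) : R := hmeas n (@unit_cube R n).
Definition bounded {n} (A : set 'rV[R]_n) := exists D : R, forall x i, A x -> `|x 0 i| <= D.

Lemma kappa_gt0 n : 0 < kappa n.
Proof. by rewrite fine_gt0// unit_cube_gt0 unit_cube_fin. Qed.

Lemma kappaE n : hausdorff_measure n (@unit_cube R n) = (kappa n)%:E.
Proof. by rewrite fineK// ge0_fin_numE ?unit_cube_fin// hausdorff_ge0. Qed.

Lemma hmeas_ge0 m s (A : set 'rV[R]_m) : 0 <= hmeas s A.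
Proof. by rewrite fine_ge0// hausdorff_ge0. Qed.

Lemma hmeasE n (A : set 'rV[R]_n) : bounded A -> hausdorff_measure n A = (hmeas n A)%:E.
Proof.
move=> [D AD]; rewrite fineK// ge0_fin_numE ?hausdorff_ge0//.
exact: hausdorff_bounded_fin AD.
Qed.

Lemma hmeas_eq m k s t (A : set 'rV[R]_m) (B : set 'rV[R]_k) :
  hausdorff_measure s A = hausdorff_measure t B -> hmeas s A = hmeas t B.
Proof. by rewrite /hmeas => ->. Qed.

Lemma boundedS n (A B : set 'rV[R]_n) : A `<=` B -> bounded B -> bounded A.
Proof. by move=> AB [D BD]; exists D => x i /AB; exact: BD. Qed.

Lemma le_hmeas n (A B : set 'rV[R]_n) : A `<=` B -> bounded B -> hmeas n A <= hmeas n B.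
Proof.
move=> AB bB; rewrite -lee_fin -!hmeasE//; last exact: boundedS AB bB.
exact: le_hausdorff.
Qed.

Lemma hmeas_fin_cover n (I : finType) (A : set 'rV[R]_n) (J : pred I) (F : I -> set 'rV[R]_n) :
  (forall i, bounded (F i)) ->
  (forall x, A x -> exists2 i, J i & F i x) -> hmeas n A <= \sum_(i | J i) hmeas n (F i).
Proof.
move=> bF AF.
have le : (hausdorff_measure n A <= (\sum_(i | J i) hmeas n (F i))%:E)%E.
  apply: le_trans (outer_measure_fin_cover _ AF) _.
  by rewrite -sumEFin; apply: lee_sum => i _; rewrite -hmeasE.
rewrite -lee_fin fineK// ge0_fin_numE ?hausdorff_ge0//.
exact: le_lt_trans le (ltry _).
Qed.

Lemma hmeas_translate n (v : 'rV[R]_n) A : hmeas n ((fun x => x + v) @` A) = hmeas n A.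
Proof. by apply: hmeas_eq; exact: hausdorff_translate. Qed.

Lemma bounded_translate n (v : 'rV[R]_n) A : bounded A -> bounded ((fun x => x + v) @` A).
Proof.
move=> [D AD]; exists (D + \sum_i `|v 0 i|) => _ i [x Ax <-]; rewrite mxE.
apply: le_trans (ler_normD _ _) _; apply: lerD; first exact: AD.
by rewrite (bigD1 i)//= lerDl sumr_ge0.
Qed.

Lemma bounded_box n (a : 'rV[R]_n) r : bounded (box a r).
Proof.
exists (`|r| + \sum_i `|a 0 i|) => x i xa; have /andP[x1 x2] := xa i.
have := ler_norm r; have : `|a 0 i| <= \sum_i `|a 0 i|.
  by rewrite (bigD1 i)//= lerDl sumr_ge0.
have := ler_norm (a 0 i); have := lerNnormlW (lexx `|a 0 i|).
have := normr_ge0 r.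
move=> *; rewrite ler_norml; apply/andP; split; lra.
Qed.

Lemma hmeas_box n (a : 'rV[R]_n) r : 0 < r -> hmeas n (box a r) = r ^+ n * kappa n.
Proof.
by move=> r0; apply: EFin_inj; rewrite -hmeasE ?box_measure ?kappaE//; exact: bounded_box.
Qed.

Lemma bernoulli_ge n (t : R) : 0 <= t <= 1 -> 1 - n%:R * t <= (1 - t) ^+ n.
Proof.
move=> /andP[t0 t1]; elim: n => [|n ih]; first by rewrite mul0r subr0 expr0.
have n0 : 0 <= n%:R :> R by [].
rewrite exprS; apply: (@le_trans _ _ ((1 - t) * (1 - n%:R * t))).
  by rewrite -natr1; nra.
by apply: ler_wpM2l => //; lra.
Qed.

Definition corner n (o e : R) (k : 'I_n -> nat) : 'rV[R]_n := \row_i (o + (k i)%:R * e).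

(** The closed cells of a grid touch each other; shrunk by the factor 1 - 1 / (2 n)
they become separated and keep, by the inequality of Bernoulli, at least half of
their measure. *)
Lemma grid_lower n (o e : R) (I : finType) (p : I -> 'I_n -> nat) (P : pred I)
    (Z : set 'rV[R]_n) :
  (0 < n)%N -> 0 < e -> (forall i j, i != j -> exists l, p i l != p j l) ->
  bounded Z -> (forall i, P i -> box (corner o e (p i)) e `<=` Z) ->
  #|P|%:R * e ^+ n * kappa n <= 2 * hmeas n Z.
Proof.
move=> n0 e0 pinj bZ PZ; pose t : R := (2 * n%:R)^-1.
have nR : 1 <= n%:R :> R by rewrite ler1n.
have t0 : 0 < t by rewrite invr_gt0; lra.
have nt : n%:R * t = 2^-1 by rewrite /t invfM mulrCA divff ?mulr1// gt_eqF//; lra.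
have t1 : t <= 2^-1 by rewrite -nt ler_peMl// ltW.
pose r := (1 - t) * e.
have r0 : 0 < r by rewrite mulr_gt0//; lra.
have rle : e ^+ n <= 2 * r ^+ n.
  rewrite exprMn mulrA ler_peMl ?exprn_ge0 ?(ltW e0)//.
  have := @bernoulli_ge n t; rewrite nt (ltW t0) /= => /(_ (le_trans t1 _)) h.
  have : 1 - 2^-1 <= (1 - t) ^+ n by apply: h; lra.
  lra.
have sub i : P i -> box (corner o e (p i)) r `<=` Z.
  move=> Pi x xb; apply: (PZ i Pi) => l; have /andP[-> x2] /= := xb l.
  apply: le_trans x2 _; rewrite lerD2l /r ler_piMl//; lra.
have sum : \sum_(i | P i) hmeas n (box (corner o e (p i)) r) <= hmeas n Z.
  rewrite -lee_fin -sumEFin -hmeasE// -big_filter.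
  under eq_bigr do rewrite -(hmeasE (@bounded_box _ _ _)).
  apply: le_trans (hausdorff_separated_seq _ _ _) _.
  - by rewrite filter_uniq// index_enum_uniq.
  - move=> i j /pinj[l pl]; exists (t * e); first by rewrite mulr_gt0.
    move=> x y xi yj; exists l.
    have := xi l; have := yj l; rewrite !mxE /r => /andP[y1 y2] /andP[x1 x2].
    move: pl; rewrite neq_ltn => /orP[] lt.
      have : (p i l).+1%:R * e <= (p j l)%:R * e by rewrite ler_pM2r// ler_nat.
      rewrite -natr1 mulrDl mul1r distrC => ?; apply: le_trans (ler_norm _); lra.
    have : (p j l).+1%:R * e <= (p i l)%:R * e by rewrite ler_pM2r// ler_nat.
    rewrite -natr1 mulrDl mul1r => ?; apply: le_trans (ler_norm _); lra.
  - apply: le_hausdorff; rewrite big_filter.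
    elim/big_ind: _ => // A B AZ BZ.
    by move=> x [/AZ|/BZ].
move: sum; under eq_bigr do rewrite hmeas_box//.
rewrite sumr_const -[X in X <= _ -> _]mulr_natl => sum.
rewrite -(ler_pM2l (x := 2)) // in sum; apply: le_trans sum.
rewrite mulrCA -mulrA ler_wpM2l// mulrA.
by apply: ler_wpM2r => //; rewrite ltW// kappa_gt0.
Qed.

(** Monotonicity of the integral for simple functions, with the sets split one
after the other: on X `&` A i the constant c increases by g i, on the rest it
does not change. *)
Lemma nonneg_combination (T I : Type) (mu : set T -> R) (A : I -> set T) (g : I -> R)
    (r : seq I) (c : R) (X : set T) :
  mu set0 = 0 -> (forall Y, 0 <= mu Y) ->
  (forall i Y, Y `<=` X -> mu Y = mu (Y `&` A i) + mu (Y `&` ~` A i)) ->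
  (forall z, X z -> 0 <= c + \sum_(i <- r) g i * \1_(A i) z) ->
  0 <= c * mu X + \sum_(i <- r) g i * mu (X `&` A i).
Proof.
move=> mu0 mu_ge0; elim: r c X => [|i r ih] c X add pos.
  rewrite big_nil addr0; have [->|/set0P[z Xz]] := eqVneq X set0; first by rewrite mu0 mulr0.
  by rewrite mulr_ge0//; have := pos z Xz; rewrite big_nil addr0.
have h1 := ih (c + g i) (X `&` A i) _ _.
have h2 := ih c (X `&` ~` A i) _ _.
have {}h1 := h1 (fun j Y YX => add j Y (subset_trans YX (@subIsetl _ _ _))).
have {}h2 := h2 (fun j Y YX => add j Y (subset_trans YX (@subIsetl _ _ _))).
have {}h1 : 0 <= (c + g i) * mu (X `&` A i) + \sum_(j <- r) g j * mu (X `&` A i `&` A j).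
  apply: h1 => z [Xz Az]; have := pos z Xz.
  by rewrite big_cons indicE mem_set// mulr1 addrA.
have {}h2 : 0 <= c * mu (X `&` ~` A i) + \sum_(j <- r) g j * mu (X `&` ~` A i `&` A j).
  apply: h2 => z [Xz Az]; have := pos z Xz.
  by rewrite big_cons indicE memNset// mulr0 add0r.
have := addr_ge0 h1 h2; rewrite big_cons (add i X)//.
rewrite (_ : \sum_(j <- r) g j * mu (X `&` A j) =
   \sum_(j <- r) g j * mu (X `&` A i `&` A j) +
   \sum_(j <- r) g j * mu (X `&` ~` A i `&` A j)); first by move=> ?; lra.
rewrite -big_split; apply: eq_bigr => j _ /=; rewrite -mulrDr; congr (_ * _).
by rewrite (add i (X `&` A j))// 1?setIAC 1?[X in _ + mu X = _]setIAC.
Qed.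

End RealMeasure.

(** * Shadows and exit sets *)

Section Sweep.
Context {R : realType}.

Definition axis0 m : 'rV[R]_m.+1 := delta_mx 0 0.
Definition tail_coords m (x : 'rV[R]_m.+1) : 'rV[R]_m := \row_j x 0 (lift ord0 j).

(** Cells of a grid of side t that meet the shadow of S serve for both
estimates: they cover the shadow, and the columns over them, above the top of W,
are covered by the translates of the exit set by multiples of h. A point of such
a column is moved down by steps of h; since W contains a segment of length at
least h of its line, it enters W, and the first time that it does so it is in the
exit set. The factor 4 comes from the touching cells and from columns of height
N t whose points are at most 2 N t above S. *)
Lemma sweep_axis0 m (S W : set 'rV[R]_m.+1) (t D h : R) :
  (forall (w : 'rV[R]_m.+1) i, W w -> `|w 0 i| <= D) -> 0 < h -> h <= t ->
  (forall s y : 'rV[R]_m.+1, S s -> (forall i, `|y 0 i - s 0 i| <= t) -> W y) ->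
  h * hmeas m (@tail_coords m @` S) * kappa m.+1 <=
  4 * kappa m * hmeas m.+1 [set w | W w /\ ~ W (w + h *: axis0 m)].
Proof.
move=> WD h0 ht SW; set E := [set w | W w /\ _].
have t0 : 0 < t by exact: lt_le_trans ht.
have SsubW s : S s -> W s by move=> Ss; apply: (SW s) => // i; rewrite subrr normr0 ltW.
have bE : bounded E by exists D => w i [Ww _]; exact: WD.
have [->|/set0P[s1 Ss1]] := eqVneq S set0.
  rewrite image_set0 {1}/hmeas hausdorff0 /= mulr0 mul0r !mulr_ge0 ?hmeas_ge0//.
have D0 : 0 <= D by apply: le_trans (WD s1 ord0 (SsubW _ Ss1)).
(* N cells cover [-D, D] and reach, when stacked from -D, above the top of W. *)
pose N := (Num.truncn ((2 * D + 1) / t)).+1.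
have Nt : 2 * D + 1 < N%:R * t by rewrite -ltr_pdivrMr// truncnS_gt.
pose cellA (f : {ffun 'I_m -> 'I_N}) := box (cell (- D) t f) t.
pose J : {pred {ffun 'I_m -> 'I_N}} := [pred f | `[< (cellA f `&` (@tail_coords m @` S)) !=set0 >]].
have upper : hmeas m (@tail_coords m @` S) <= #|J|%:R * t ^+ m * kappa m.
  apply: (@le_trans _ _ (\sum_(f | J f) hmeas m (cellA f))).
    apply: hmeas_fin_cover => [f|_ [s Ss <-]]; first exact: bounded_box.
    have [|f fs] := @cell_cover R m N (- D) t (tail_coords s) t0.
      move=> i; rewrite mxE; have := WD s (lift ord0 i) (SsubW s Ss).
      by rewrite ler_norml => /andP[? ?]; apply/andP; split; lra.
    by exists f => //; apply/asboolP; exists (tail_coords s); split => //; exists s.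
  under eq_bigr do rewrite hmeas_box//.
  by rewrite sumr_const -[X in X <= _]mulr_natl mulrA.
(* The columns occupy the cells N, ..., 2 N - 1 in the direction of axis0. *)
pose p (fi : {ffun 'I_m -> 'I_N} * 'I_N) (l : 'I_m.+1) : nat :=
  if unlift ord0 l is Some j then fi.1 j else (N + fi.2)%N.
pose P := [predX J & predT : pred 'I_N].
pose Z : set 'rV[R]_m.+1 := \bigcup_(fi in [set fi | P fi]) box (corner (- D) t (p fi)) t.
pose M := Num.truncn ((2 * N)%:R * t / h).
have Zcover z : Z z -> exists2 j : 'I_M, true & ((fun x => x + (j.+1%:R * h) *: axis0 m) @` E) z.
  move=> [[f i] /andP[/asboolP[y [fy [s Ss tls]]] _] zb]; subst y.
  have z0 := zb ord0; rewrite mxE /p unlift_none /= in z0.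
  have zj j := zb (lift ord0 j).
  have Ws := SsubW s Ss.
  have := WD s ord0 Ws; rewrite ler_norml => /andP[sD1 sD2].
  have iN : (i%:R + 1) * t <= N%:R * t.
    by rewrite ler_pM2r// natr1 ler_nat.
  have it0 : 0 <= i%:R * t by rewrite mulr_ge0// ltW.
  have zlow : D + 1 < z 0 ord0.
    by move: z0 => /andP[z01 _]; move: z01; rewrite natrD mulrDl; lra.
  have zup : z 0 ord0 - s 0 ord0 <= (2 * N)%:R * t.
    move: z0 => /andP[_ z02]; move: z02; rewrite natrD natrM mulrDl; lra.
  have q0 : 0 <= (z 0 ord0 - s 0 ord0) / h by rewrite divr_ge0 ?(ltW h0)//; lra.
  pose k := Num.truncn ((z 0 ord0 - s 0 ord0) / h).
  have kM : (k <= M)%N.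
    by apply: le_truncn; rewrite ler_pM2r ?invr_gt0.
  have Wk : W (z - (k%:R * h) *: axis0 m).
    apply: (SW s) => // l; rewrite !mxE.
    have [j ->|->] := unliftP ord0 l.
      rewrite andbF mulr0 subr0.
      have := zj j; have := fy j; rewrite !mxE /p liftK /= => /andP[? ?] /andP[? ?].
      by rewrite ler_norml; apply/andP; split; lra.
    rewrite !eqxx mulr1.
    have /andP[] := truncn_itv q0; rewrite -/k ler_pdivlMr// ltr_pdivrMr// -natr1 mulrDl mul1r.
    by move=> *; rewrite ler_norml; apply/andP; split; lra.
  have exk : exists k, `[< W (z - (k%:R * h) *: axis0 m) >] by exists k; exact/asboolP.
  (* z itself is above W, so the first time is at least 1. *)
  case: (ex_minnP exk) => -[|j] /asboolP Wj jmin.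
    have := WD _ ord0 Wj; rewrite mul0r scale0r subr0 ler_norml => /andP[_]; lra.
  have jM : (j < M)%N by apply: leq_trans kM; apply: jmin; exact/asboolP.
  exists (Ordinal jM) => //; exists (z - (j.+1%:R * h) *: axis0 m); last by rewrite subrK.
  split => // Wj'; have := jmin j; rewrite ltnn => /(_ _)/negP; apply => //.
  apply/asboolP; move: Wj'; congr W.
  by rewrite -addrA -scaleNr -scalerDl -natr1 mulrDl mul1r opprD subrK scaleNr.
have bZ : bounded Z.
  exists ((2 * N)%:R * t + (2 * D)) => z l [[f i] _ zb].
  have := zb l; rewrite mxE => /andP[z1 z2].
  have pN : (p (f, i) l).+1%:R * t <= (2 * N)%:R * t.
    rewrite ler_pM2r// ler_nat /p /= mul2n -addnn.
    by case: unlift => [j|]; rewrite ?(leq_trans (ltn_ord _))// ?leq_addr// -addnS leq_add2l.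
  have p0 : 0 <= (p (f, i) l)%:R * t by rewrite mulr_ge0// ltW.
  move: pN; rewrite -natr1 mulrDl mul1r => pN.
  by rewrite ler_norml; apply/andP; split; lra.
have lower : #|P|%:R * t ^+ m.+1 * kappa m.+1 <= 2 * hmeas m.+1 Z.
  apply: (@grid_lower _ _ (- D) t _ p) => //.
    move=> [f i] [g j]; rewrite xpair_eqE negb_and => /orP[fg|ij].
      have /existsP[l fgl] : [exists l, f l != g l].
        apply: contraR fg => /existsPn H; apply/eqP/ffunP => l.
        by apply/eqP; have := H l; rewrite negbK.
      by exists (lift ord0 l); rewrite /p liftK.
    by exists ord0; rewrite /p unlift_none /= eqn_add2l.
  by move=> fi Pfi z zb; exists fi.
have ZE : hmeas m.+1 Z <= M%:R * hmeas m.+1 E.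
  apply: (@le_trans _ _ (\sum_(j < M | true) hmeas m.+1 ((fun x => x + (j.+1%:R * h) *: axis0 m) @` E))).
    by apply: hmeas_fin_cover Zcover => j; exact: bounded_translate.
  under eq_bigr do rewrite hmeas_translate.
  by rewrite sumr_const card_ord -[X in X <= _]mulr_natl.
have MN : M%:R <= (2 * N)%:R * t / h.
  by rewrite truncn_le divr_ge0 ?(ltW h0)// mulr_ge0// ltW.
have N0 : 0 < N%:R :> R by [].
have cardP : #|P| = (#|J| * N)%N by rewrite cardX card_ord.
have final : N%:R * t * (h * (#|J|%:R * t ^+ m * kappa m.+1)) <=
             N%:R * t * (4 * hmeas m.+1 E).
  have -> : N%:R * t * (h * (#|J|%:R * t ^+ m * kappa m.+1)) =
     h * (#|P|%:R * t ^+ m.+1 * kappa m.+1) by rewrite cardP natrM exprS; ring.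
  apply: (@le_trans _ _ (h * (2 * (((2 * N)%:R * t / h) * hmeas m.+1 E)))).
    rewrite ler_pM2l//; apply: le_trans lower _; rewrite ler_pM2l//.
    by apply: le_trans ZE _; rewrite ler_wpM2r// hmeas_ge0.
  rewrite natrM le_eqVlt; apply/orP; left; apply/eqP; field.
  by rewrite gt_eqF.
have {}final : h * (#|J|%:R * t ^+ m * kappa m.+1) <= 4 * hmeas m.+1 E.
  by move: final; rewrite ler_pM2l// mulr_gt0.
have k0 := kappa_gt0 (R := R) m; have k1 := kappa_gt0 (R := R) m.+1.
apply: (@le_trans _ _ (h * (#|J|%:R * t ^+ m * kappa m) * kappa m.+1)).
  by rewrite ler_pM2r// ler_pM2l.
rewrite [leLHS](_ : _ = kappa m * (h * (#|J|%:R * t ^+ m * kappa m.+1))); last by ring.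
by rewrite [leRHS](_ : _ = kappa m * (4 * hmeas m.+1 E)) ?ler_pM2l//; ring.
Qed.

End Sweep.

(** * Reflections and arbitrary directions *)

Section Reflection.
Context {R : realType}.

Section Dotp.
Context {n : nat}.
Implicit Types x y z u : 'rV[R]_n.

Lemma dotpC x y : dotp x y = dotp y x.
Proof. by apply: eq_bigr => i _; rewrite mulrC. Qed.

Lemma dotpBl x y z : dotp (x - y) z = dotp x z - dotp y z.
Proof. by rewrite -sumrB; apply: eq_bigr => i _; rewrite !mxE mulrBl. Qed.

Lemma dotpZl a x z : dotp (a *: x) z = a * dotp x z.
Proof. by rewrite mulr_sumr; apply: eq_bigr => i _; rewrite !mxE mulrA. Qed.

Lemma dotpBr x y z : dotp z (x - y) = dotp z x - dotp z y.
Proof. by rewrite dotpC dotpBl !(dotpC z). Qed.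

Lemma dotpZr a x z : dotp z (a *: x) = a * dotp z x.
Proof. by rewrite dotpC dotpZl (dotpC z). Qed.

Lemma dotp_eq0 x : dotp x x = 0 -> x = 0.
Proof. by move=> xx; apply: euclid_eq0; rewrite /euclid_norm xx sqrtr0. Qed.

(** The reflection through the hyperplane orthogonal to u, and the identity for
u = 0, division by 0 giving 0. *)
Definition mirror u y := y - (2 * dotp y u / dotp u u) *: u.

Lemma mirrorB u y z : mirror u (y - z) = mirror u y - mirror u z.
Proof. by apply/rowP => i; rewrite /mirror dotpBl !mxE; ring. Qed.

Lemma mirrorZ u a y : mirror u (a *: y) = a *: mirror u y.
Proof. by apply/rowP => i; rewrite /mirror dotpZl !mxE; ring. Qed.

Lemma mirror_dotp u y z : dotp (mirror u y) (mirror u z) = dotp y z.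
Proof.
rewrite /mirror; have [/dotp_eq0 ->|uu] := eqVneq (dotp u u) 0; first by rewrite !scaler0 !subr0.
rewrite dotpBl !dotpBr !dotpZl !dotpZr (dotpC u z); field.
exact: uu.
Qed.

Lemma mirrorK u : involutive (mirror u).
Proof.
move=> y; rewrite {1}/mirror.
have [/dotp_eq0 u0|uu] := eqVneq (dotp u u) 0.
  by rewrite u0 scaler0 subr0 /mirror scaler0 subr0.
apply/rowP => i; rewrite /mirror dotpBl dotpZl !mxE; field.
exact: uu.
Qed.

Lemma euclid_mirror u y z : euclid_norm (mirror u y - mirror u z) = euclid_norm (y - z).
Proof. by rewrite -mirrorB /euclid_norm mirror_dotp. Qed.

(** This is how a unit vector is moved to the first basis vector. *)
Lemma mirror_swap x y : dotp x x = dotp y y -> mirror (x - y) x = y.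
Proof.
move=> xy; rewrite /mirror; have [/dotp_eq0 u0|uu] := eqVneq (dotp (x - y) (x - y)) 0.
  by rewrite u0 scaler0 subr0; apply/eqP; rewrite -subr_eq0 u0.
have c1 : 2 * dotp x (x - y) / dotp (x - y) (x - y) = 1.
  move: uu; rewrite !dotpBr !dotpBl -xy (dotpC y x) => uu.
  rewrite (_ : 2 * (dotp x x - dotp x y) = dotp x x - dotp x y - (dotp x y - dotp x x)).
    by rewrite divff.
  by ring.
by rewrite c1 scale1r subKr.
Qed.

Lemma hausdorff_mirror s u (A : set 'rV[R]_n) :
  hausdorff_measure s (mirror u @` A) = hausdorff_measure s A.
Proof.
rewrite (@hausdorff_similarity _ _ _ _ _ 1)// ?expr1n ?mul1e// => x y _ _.
by rewrite mul1r euclid_mirror.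
Qed.

Lemma bounded_mirror u (A : set 'rV[R]_n) : bounded A -> bounded (mirror u @` A).
Proof.
move=> [D AD]; exists (n%:R * `|D|) => _ i [x Ax <-].
have -> : mirror u x = mirror u x - mirror u 0.
  by rewrite -mirrorB subr0.
apply: le_trans (coord_le_euclid _ _) _; rewrite euclid_mirror subr0.
apply: euclid_le_coord => // j; apply: le_trans (AD x j Ax) (ler_norm _).
Qed.

End Dotp.

Lemma dotp_axis0 m (y : 'rV[R]_m.+1) : dotp y (@axis0 R m) = y 0 ord0.
Proof.
rewrite /dotp (bigD1 ord0)//= big1 => [|i i0]; first by rewrite mxE !eqxx mulr1 addr0.
by rewrite mxE (negbTE i0) andbF mulr0.
Qed.

Lemma hausdorff_proj_axis0 m (S : set 'rV[R]_m.+1) :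
  hausdorff_measure m (proj_perp (@axis0 R m) @` S) = hausdorff_measure m (@tail_coords R m @` S).
Proof.
pose emb (x : 'rV[R]_m) : 'rV[R]_m.+1 := \row_i (if unlift ord0 i is Some j then x 0 j else 0).
have -> : proj_perp (@axis0 R m) @` S = emb @` (@tail_coords R m @` S).
  rewrite image_comp; apply: eq_imagel => y _; apply/rowP => i.
  rewrite /proj_perp !dotp_axis0 !mxE eqxx /=.
  have [j ->|->] := unliftP ord0 i; first by rewrite !mxE mulr0 subr0.
  by rewrite eqxx divr1 mulr1 subrr.
rewrite (@hausdorff_similarity _ _ _ _ _ 1)// ?expr1n ?mul1e// => x y _ _.
rewrite mul1r /euclid_norm /dotp; congr Num.sqrt.
rewrite big_ord_recl !mxE unlift_none subrr mul0r add0r.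
by apply: eq_bigr => i _; rewrite !mxE liftK.
Qed.

(** A reflection reduces the shadow along x to the coordinate projection, whose
image lives in a space of dimension m. *)
Lemma hausdorff_proj m (S : set 'rV[R]_m.+1) (x : 'rV[R]_m.+1) : dotp x x = 1 ->
  hausdorff_measure m (proj_perp x @` S) =
  hausdorff_measure m (@tail_coords R m @` (mirror (x - axis0 m) @` S)).
Proof.
move=> xx; pose u := x - axis0 m.
have Qx : mirror u x = axis0 m by apply: mirror_swap; rewrite xx dotp_axis0 mxE !eqxx.
have Qe : mirror u (axis0 m) = x by rewrite -Qx mirrorK.
rewrite -/u -hausdorff_proj_axis0 -[RHS](hausdorff_mirror _ u) !image_comp.
congr (hausdorff_measure m _); apply: eq_imagel => y _.
rewrite /= /proj_perp mirrorB mirrorZ Qe mirrorK.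
by congr (_ - (_ / _) *: _); [rewrite -Qx mirror_dotp|rewrite dotp_axis0 mxE !eqxx xx].
Qed.

Lemma hausdorff_proj_fin m (S : set 'rV[R]_m.+1) (x : 'rV[R]_m.+1) :
  dotp x x = 1 -> bounded S -> (hausdorff_measure m (proj_perp x @` S) < +oo)%E.
Proof.
move=> xx bS; rewrite hausdorff_proj//; have [D SD] := bounded_mirror (x - axis0 m) bS.
apply: (@hausdorff_bounded_fin _ _ _ D) => _ i [y Sy <-]; rewrite mxE; exact: SD.
Qed.

(** The factor m.+1 is lost in comparing the Euclidean ball, which the reflection
preserves, with cubes; it only restricts how small h has to be. *)
Lemma sweep m (S W : set 'rV[R]_m.+1) (x : 'rV[R]_m.+1) (t h : R) :
  dotp x x = 1 -> bounded W -> 0 < h -> m.+1%:R * h <= t ->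
  (forall s y : 'rV[R]_m.+1, S s -> (forall i, `|y 0 i - s 0 i| <= t) -> W y) ->
  h * hmeas m (proj_perp x @` S) * kappa m.+1 <=
  4 * kappa m * hmeas m.+1 [set w | W w /\ ~ W (w + h *: x)].
Proof.
move=> xx bW h0 ht SW; pose u := x - axis0 m; pose Q := mirror u.
have Qx : Q x = axis0 m by apply: mirror_swap; rewrite xx dotp_axis0 mxE !eqxx.
have [D QWD] := bounded_mirror u bW.
rewrite {1}/hmeas hausdorff_proj// -/(hmeas _ _) -/u -/Q.
have -> : hmeas m.+1 [set w | W w /\ ~ W (w + h *: x)] =
          hmeas m.+1 [set w | (Q @` W) w /\ ~ (Q @` W) (w + h *: axis0 m)].
  rewrite -(hmeas_eq (hausdorff_mirror _ u _)); congr (hmeas _ _).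
  have QD w : Q (w + h *: x) = Q w + h *: axis0 m.
    by rewrite -[h *: x]opprK /Q mirrorB -scaleNr mirrorZ -/Q Qx scaleNr opprK.
  rewrite predeqE => w; split => [[z [Wz nWz] <-]|[[z Wz <-] nW]].
    split; first by exists z.
    move=> [z' Wz']; rewrite -QD => /(congr1 Q); rewrite /Q !mirrorK => zz.
    by apply: nWz; rewrite -zz.
  by exists z => //; split => // Wzh; apply: nW; exists (z + h *: x).
apply: (@sweep_axis0 _ _ _ _ (t / m.+1%:R) D) => //.
- by rewrite ler_pdivlMr ?ltr0Sn// mulrC.
- move=> _ y [s Ss <-] ys; exists (Q y); last by rewrite /Q mirrorK.
  apply: (SW s) => // i.
  have -> : Q y 0 i - s 0 i = (Q y - s) 0 i by rewrite !mxE.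
  apply: le_trans (coord_le_euclid _ _) _.
  have -> : euclid_norm (Q y - s) = euclid_norm (y - Q s).
    by rewrite -[in RHS](mirrorK u y) euclid_mirror.
  apply: le_trans (euclid_le_coord (r := t / m.+1%:R) _ _) _.
  + exact: le_trans (normr_ge0 _) (ys i).
  + by move=> j; rewrite mxE [X in _ + X]mxE; exact: ys.
  + by rewrite mulrC divfK.
Qed.

End Reflection.

(** * The barrier function *)

Section Barrier.
Context {R : realType}.
Implicit Types u v a b s : R.

(** A convex even function that vanishes at 0, blows up at -1 and 1, and has a
derivative bounded by a polynomial in phi. *)
Definition phi u : R := (1 - u ^+ 2)^-1 - 1.
Definition dphi u : R := 2 * u / (1 - u ^+ 2) ^+ 2.

Lemma sqr_lt1 u : `|u| < 1 -> 0 < 1 - u ^+ 2.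
Proof. by rewrite ltr_norml => /andP[? ?]; nra. Qed.

Lemma phiN u : phi (- u) = phi u. Proof. by rewrite /phi sqrrN. Qed.

Lemma phi0 : phi 0 = 0. Proof. by rewrite /phi expr0n subr0 invr1 subrr. Qed.

Lemma phi_ge0 u : `|u| < 1 -> 0 <= phi u.
Proof.
move=> /sqr_lt1 u1; rewrite subr_ge0 invf_ge1//.
by rewrite lerBlDr lerDl sqr_ge0.
Qed.

Lemma phi_tangent u v : `|u| < 1 -> `|v| < 1 -> phi u + dphi u * (v - u) <= phi v.
Proof.
move=> /sqr_lt1 u1 /sqr_lt1 v1; rewrite -subr_ge0.
have -> : phi v - (phi u + dphi u * (v - u)) =
    ((v - u) ^+ 2 * ((u + v) ^+ 2 + (1 - v ^+ 2))) / ((1 - u ^+ 2) ^+ 2 * (1 - v ^+ 2)).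
  by rewrite /phi /dphi; field; rewrite ?gt_eqF//.
by apply: divr_ge0; apply: mulr_ge0; rewrite ?sqr_ge0 ?(ltW v1)//; apply: addr_ge0; rewrite ?sqr_ge0 ?(ltW v1).
Qed.

Lemma phi_convex u v t : 0 <= t <= 1 -> `|u| < 1 -> `|v| < 1 ->
  `|t * u + (1 - t) * v| < 1 /\ phi (t * u + (1 - t) * v) <= t * phi u + (1 - t) * phi v.
Proof.
move=> /andP[t0 t1] u1 v1; set w := _ + _.
have w1 : `|w| < 1.
  rewrite /w; have [->|tn0] := eqVneq t 0; first by rewrite mul0r add0r subr0 mul1r.
  have tgt0 : 0 < t by rewrite lt_neqAle eq_sym tn0.
  by move: u1 v1; rewrite !ltr_norml => /andP[? ?] /andP[? ?]; apply/andP; split; nra.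
split => //; have hu := phi_tangent w1 u1; have hv := phi_tangent w1 v1.
have t1' : 0 <= 1 - t by lra.
have := lerD (ler_wpM2l t0 hu) (ler_wpM2l t1' hv).
rewrite (_ : t * (phi w + dphi w * (u - w)) + (1 - t) * (phi w + dphi w * (v - w)) = phi w)//.
by rewrite /w; ring.
Qed.

(** Taylor expansion from above, with a constant that is uniform away from the
singularities. It follows from the exact identity for 1 / (x - y) in terms of
1 / x, applied to both terms of 1 / (1 - u) + 1 / (1 + u) = 2 (phi u + 1). *)
Lemma phi_step b : 0 <= b < 1 -> exists B e : R, [/\ 0 <= B, 0 < e &
  forall u s, `|u| <= b -> `|s| <= e ->
    `|u + s| < 1 /\ phi (u + s) <= phi u + dphi u * s + B * s ^+ 2].
Proof.
move=> /andP[b0 b1]; pose e := (1 - b) / 2.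
have e0 : 0 < e by rewrite divr_gt0//; lra.
exists (e ^+ 3)^-1, e; split => // [|u s]; first by rewrite invr_ge0 exprn_ge0// ltW.
rewrite !ler_norml => /andP[u1 u2] /andP[s1 s2].
have eE : 1 - b = 2 * e by rewrite /e mulrC divfK.
have us1 : `|u + s| < 1 by rewrite ltr_norml; apply/andP; split; lra.
split => //.
have rem (x y : R) : e <= x -> e <= x - y ->
    (x - y)^-1 <= x^-1 + y / x ^+ 2 + y ^+ 2 / e ^+ 3.
  move=> xe xye; have x0 : 0 < x by lra.
  have xy0 : 0 < x - y by lra.
  have -> : (x - y)^-1 = x^-1 + y / x ^+ 2 + y ^+ 2 / (x ^+ 2 * (x - y)).
    by field; rewrite ?gt_eqF//.
  have e3 : 0 < e ^+ 3 by rewrite exprn_gt0.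
  have x3 : 0 < x ^+ 2 * (x - y) by rewrite mulr_gt0// exprn_gt0.
  have le3 : e ^+ 3 <= x ^+ 2 * (x - y).
    rewrite exprSr; apply: ler_pM => //; rewrite ?exprn_ge0 ?(ltW e0)//.
    by apply: lerXn2r => //; rewrite nnegrE ltW.
  by rewrite lerD2l; apply: ler_wpM2l; rewrite ?sqr_ge0// lef_pV2 ?posrE.
have split2 x : `|x| < 1 -> phi x = 2^-1 * ((1 - x)^-1 + (1 + x)^-1) - 1.
  rewrite ltr_norml => /andP[x1 x2]; rewrite /phi.
  have -> : 1 - x ^+ 2 = (1 - x) * (1 + x) by ring.
  by field; rewrite ?gt_eqF//; lra.
have u1' : `|u| < 1 by rewrite ltr_norml; apply/andP; split; lra.
have dE : dphi u = 2^-1 * (((1 - u) ^+ 2)^-1 - ((1 + u) ^+ 2)^-1).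
  rewrite /dphi; have -> : 1 - u ^+ 2 = (1 - u) * (1 + u) by ring.
  by field; rewrite ?gt_eqF//; lra.
rewrite !split2// dE.
have e1 : 1 - (u + s) = 1 - u - s by ring.
have e2 : 1 + (u + s) = 1 + u - - s by ring.
rewrite e1 e2.
have r1 : (1 - u - s)^-1 <= (1 - u)^-1 + s / (1 - u) ^+ 2 + s ^+ 2 / e ^+ 3.
  by apply: rem; lra.
have r2 : (1 + u - - s)^-1 <= (1 + u)^-1 + (- s) / (1 + u) ^+ 2 + (- s) ^+ 2 / e ^+ 3.
  by apply: rem; lra.
rewrite sqrrN in r2; move: r1 r2.
move: ((1 - u) ^+ 2)^-1 ((1 + u) ^+ 2)^-1 (1 - u - s)^-1 (1 + u - - s)^-1 => A1 A2 A3 A4.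
move: (1 - u)^-1 (1 + u)^-1 (e ^+ 3)^-1 (s ^+ 2) => A5 A6 A7 A8 r1 r2; lra.
Qed.

(** phi x / x is nondecreasing, so phi a + phi (u - a) <= phi u. *)
Lemma phi_superadd a u : 0 <= a -> a <= u -> u < 1 ->
  `|u - a| < 1 /\ phi (u - a) <= phi u - phi a.
Proof.
move=> a0 au u1; have d0 : 0 <= u - a by rewrite subr_ge0.
split; first by rewrite ger0_norm//; lra.
have key x : 0 <= x -> x <= u -> phi x <= x * (u / (1 - u ^+ 2)).
  move=> x0 xu; have x1 : 0 < 1 - x ^+ 2 by nra.
  have u1' : 0 < 1 - u ^+ 2 by nra.
  rewrite (_ : phi x = x * (x / (1 - x ^+ 2))).
    have xu2 : 1 - u ^+ 2 <= 1 - x ^+ 2.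
      by rewrite lerD2l lerN2; apply: lerXn2r => //; rewrite nnegrE; lra.
    apply: ler_wpM2l => //; apply: ler_pM => //; first by rewrite invr_ge0 ltW.
    by rewrite lef_pV2 ?posrE.
  by rewrite /phi; field; rewrite gt_eqF.
have h1 := key _ d0 _; have h2 := key _ a0 au.
have {}h1 : phi (u - a) <= (u - a) * (u / (1 - u ^+ 2)) by apply: h1; lra.
have : phi u = u * (u / (1 - u ^+ 2)).
  by rewrite /phi; field; rewrite gt_eqF//; nra.
have -> : u * (u / (1 - u ^+ 2)) = (u - a) * (u / (1 - u ^+ 2)) + a * (u / (1 - u ^+ 2)) by ring.
by lra.
Qed.

(** The solution of phi a = j. *)
Definition level (j : nat) : R := Num.sqrt (j%:R / (j%:R + 1)).

Lemma level_sqr j : level j ^+ 2 = j%:R / (j%:R + 1).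
Proof. by rewrite sqr_sqrtr// divr_ge0// addr_ge0. Qed.

Lemma phi_level j : phi (level j) = j%:R.
Proof.
have j0 : 0 <= j%:R :> R by [].
by rewrite /phi level_sqr; field; rewrite ?gt_eqF//; lra.
Qed.

Lemma level_le j u : `|u| < 1 -> j%:R <= phi u -> level j <= `|u|.
Proof.
move=> u1; have u2 := sqr_lt1 u1; rewrite /phi lerBrDr => ju.
have j0 : 0 <= j%:R :> R by [].
rewrite -ler_sqr ?nnegrE ?sqrtr_ge0// level_sqr real_normK ?num_real//.
rewrite ler_pdivrMr; last by lra.
have : (j%:R + 1) * (1 - u ^+ 2) <= 1 by rewrite -ler_pdivlMr// div1r.
by rewrite mulrBr; lra.
Qed.

(** dphi u ^+ 2 = 4 * u ^+ 2 * (phi u + 1) ^+ 4, and j + 2 <= 2 ^+ j.+1. *)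
Lemma dphi_le u j : `|u| < 1 -> phi u <= j%:R + 1 -> dphi u ^+ 2 <= 64 * 16 ^+ j.
Proof.
move=> u1 uj; have u2 := sqr_lt1 u1.
have -> : dphi u ^+ 2 = 4 * u ^+ 2 * (phi u + 1) ^+ 4.
  by rewrite /dphi /phi; field; rewrite gt_eqF.
have u4 : u ^+ 2 <= 1 by lra.
have p0 := phi_ge0 u1.
have pj : phi u + 1 <= 2 ^+ j.+1.
  apply: le_trans (_ : j.+2%:R <= _); first by rewrite -!natr1; lra.
  by rewrite -natrX ler_nat ltn_expl.
have p4 : (phi u + 1) ^+ 4 <= 16 * 16 ^+ j.
  rewrite -exprS (_ : (16 : R) = 2 ^+ 4); last by rewrite -natrX.
  rewrite -exprM mulnC exprM; apply: lerXn2r => //; rewrite ?nnegrE ?exprn_ge0//; lra.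
have : 0 <= (phi u + 1) ^+ 4 by rewrite exprn_ge0//; lra.
have := sqr_ge0 u; move: p4 u4; move: ((phi u + 1) ^+ 4) (16 ^+ j) (u ^+ 2) => x y z.
nra.
Qed.

Lemma phi_lt_norm u r : `|u| < 1 -> 0 < r -> phi u < r -> `|u| <= 1 - (2 * (1 + r))^-1.
Proof.
move=> u1 r0; have u2 := sqr_lt1 u1; rewrite /phi ltrBlDr => ur.
have h : 1 < (r + 1) * (1 - u ^+ 2) by rewrite -ltr_pdivrMr// div1r.
have r1 : 0 < 2 * (1 + r) by lra.
have x0 := normr_ge0 u; have ux : u ^+ 2 = `|u| ^+ 2 by rewrite real_normK ?num_real.
rewrite ux in h; rewrite lerBrDr -lerBrDl -div1r ler_pdivrMr//.
by move: h x0 u1; move: `|u| => x; nra.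
Qed.

End Barrier.

(** * The rounded bodies *)

Section SmoothedBody.
Context {R : realType} {n : nat}.
Implicit Types (x y z v w : 'rV[R]_n) (r : R).

Definition sperm (s : 'I_n -> bool) (p : 'I_n -> 'I_n) x : 'rV[R]_n :=
  \row_i ((-1) ^+ s i * x 0 (p i)).

Definition Phi v : R := \sum_i phi (v 0 i).

Definition open_cube : set 'rV[R]_n := [set v | forall i, `|v 0 i| < 1].

Definition sublevel r : set 'rV[R]_n := [set v | open_cube v /\ Phi v < r].

Lemma Phi_ge0 v : open_cube v -> 0 <= Phi v.
Proof. by move=> v1; apply: sumr_ge0 => i _; exact: phi_ge0. Qed.

Lemma phi_le_Phi v i : open_cube v -> phi (v 0 i) <= Phi v.
Proof.
move=> v1; rewrite /Phi (bigD1 i)//= lerDl.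
by apply: sumr_ge0 => j _; exact: phi_ge0.
Qed.

Lemma sublevel_gt0 r v : sublevel r v -> 0 < r.
Proof. by move=> [v1 vr]; apply: le_lt_trans vr; exact: Phi_ge0. Qed.

Lemma sublevel_sperm s p r v : injective p -> sublevel r v -> sublevel r (sperm s p v).
Proof.
move=> pinj [v1 vr]; split => [i|].
  by rewrite mxE normrM normrX normrN1 expr1n mul1r; exact: v1.
suff -> : Phi (sperm s p v) = Phi v by [].
rewrite [in RHS]/Phi (reindex_inj pinj); apply: eq_bigr => i _.
by rewrite mxE; case: (s i); rewrite ?expr1 ?mulN1r ?phiN// expr0 mul1r.
Qed.

Lemma sublevel_convex r v w t : 0 <= t <= 1 -> sublevel r v -> sublevel r w ->
  sublevel r (t *: v + (1 - t) *: w).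
Proof.
move=> t01 [v1 vr] [w1 wr].
have cvx i := phi_convex t01 (v1 i) (w1 i).
split => [i|]; first by rewrite !mxE; have [] := cvx i.
have t0 : 0 <= t by case/andP: t01.
have t1 : 0 <= 1 - t by rewrite subr_ge0; case/andP: t01.
apply: (@le_lt_trans _ _ (t * Phi v + (1 - t) * Phi w)).
  rewrite /Phi !mulr_sumr -big_split; apply: ler_sum => i _ /=.
  by rewrite !mxE; have [] := cvx i.
have [->|tn0] := eqVneq t 0; first by rewrite mul0r add0r subr0 mul1r.
have tgt0 : 0 < t by rewrite lt_neqAle eq_sym tn0.
by nra.
Qed.

Lemma sublevel_step r : exists B e : R, [/\ 0 <= B, 0 < e &
  forall v (s : 'rV[R]_n), sublevel r v -> (forall i, `|s 0 i| <= e) ->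
    open_cube (v + s) /\
    Phi (v + s) <= Phi v + \sum_i dphi (v 0 i) * s 0 i + B * \sum_i s 0 i ^+ 2].
Proof.
have [r0|r0] := leP r 0.
  by exists 0, 1; split => // v s /sublevel_gt0; rewrite ltNge r0.
have b01 : 0 <= 1 - (2 * (1 + r))^-1 < 1.
  have h : 1 <= 2 * (1 + r) by lra.
  by rewrite subr_ge0 invf_le1 ?ltrBlDr ?ltrDl ?invr_gt0 ?h//=; lra.
have [B [e [B0 e0 step]]] := phi_step b01; exists B, e; split => // v s [v1 vr] se.
have st i := step (v 0 i) (s 0 i) (phi_lt_norm (v1 i) r0 (le_lt_trans (phi_le_Phi i v1) vr)) (se i).
split => [i|]; first by rewrite mxE; have [] := st i.
rewrite /Phi mulr_sumr -!big_split; apply: ler_sum => i _ /=.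
by rewrite mxE; have [] := st i.
Qed.

Lemma sublevel_nbhd r eps : 0 < eps -> exists2 e : R, 0 < e &
  forall v (s : 'rV[R]_n), sublevel r v -> (forall i, `|s 0 i| <= e) ->
    open_cube (v + s) /\ Phi (v + s) <= Phi v + eps.
Proof.
move=> eps0; have [B [e [B0 e0 step]]] := sublevel_step r.
pose j := Num.truncn r.
pose M : R := 64 * 16 ^+ j + 1 + B.
have M0 : 0 < M by rewrite ltr_pwDl// addr_gt0// mulr_gt0// exprn_gt0.
pose d := Num.min (Num.min e 1) (eps / (n.+1%:R * M)).
have d0 : 0 < d by rewrite !lt_min e0 ltr01 divr_gt0// mulr_gt0.
have de : d <= e by rewrite !ge_min lexx.
have d1 : d <= 1 by rewrite !ge_min lexx orbT.
exists d => // v s cv sd.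
have [? H] := step v s cv (fun i => le_trans (sd i) de); split => //.
apply: le_trans H _; rewrite -addrA lerD2l mulr_sumr -big_split /=.
apply: (@le_trans _ _ (\sum_(i < n) M * d)).
  apply: ler_sum => i _.
  have [v1 vr] := cv.
  have /(dphi_le (v1 i)) dj : phi (v 0 i) <= j%:R + 1.
    apply: le_trans (phi_le_Phi i v1) (le_trans (ltW vr) _).
    by rewrite natr1 ltW// truncnS_gt.
  have {}dj : `|dphi (v 0 i)| <= 64 * 16 ^+ j + 1.
    rewrite -real_normK ?num_real// in dj; have := normr_ge0 (dphi (v 0 i)); move: dj.
    by move: `|_| (16 ^+ j) => a b; nra.
  rewrite /M mulrDl; apply: lerD.
    apply: le_trans (ler_norm _) _; rewrite normrM; apply: ler_pM => //.
  apply: ler_wpM2l => //; rewrite -real_normK ?num_real//.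
  by have := sd i; have := normr_ge0 (s 0 i); move: `|_| => a; nra.
rewrite sumr_const card_ord -[X in X <= _]mulr_natl.
apply: (@le_trans _ _ (n.+1%:R * M * (eps / (n.+1%:R * M)))).
  rewrite mulrA; apply: ler_pM => //; rewrite ?(ltW d0) ?mulr_ge0 ?(ltW M0)//.
    by rewrite ler_pM2r// ler_nat.
  by rewrite ge_min lexx orbT.
by rewrite mulrC divfK// gt_eqF// mulr_gt0.
Qed.

Context (L : set 'rV[R]_n).

(** The Minkowski sum of L and a sublevel set of the barrier. Sublevel sets are
strict, which makes the body open, as a union of translates of an open set. *)
Definition body r : set 'rV[R]_n := [set z | exists w v, [/\ L w, sublevel r v & z = w + v]].

Lemma body_le r r' : r <= r' -> body r `<=` body r'.
Proof.
move=> rr z [w [v [Lw [v1 vr] ->]]]; exists w, v; split => //; split => //.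
exact: lt_le_trans vr rr.
Qed.

Lemma body0 : body 0 = set0.
Proof. by rewrite predeqE => z; split => // -[w [v [_ /sublevel_gt0]]]; rewrite ltxx. Qed.

Lemma sub_body r : 0 < r -> L `<=` body r.
Proof.
move=> r0 w Lw; exists w, 0; rewrite addr0; split => //; split => [i|].
  by rewrite mxE normr0.
by rewrite /Phi big1// => i _; rewrite mxE phi0.
Qed.

Lemma body_bounded D : (forall w i, L w -> `|w 0 i| <= D) ->
  forall r z i, body r z -> `|z 0 i| <= D + 1.
Proof.
move=> LD r z i [w [v [Lw [v1 _] ->]]]; rewrite mxE.
by apply: le_trans (ler_normD _ _) _; rewrite lerD ?LD// ltW.
Qed.

Lemma body_sperm s p r z :
  (forall x, L x -> L (sperm s p x)) -> injective p -> body r z -> body r (sperm s p z).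
Proof.
move=> Ls pinj [w [v [Lw cv ->]]]; exists (sperm s p w), (sperm s p v).
split; [exact: Ls|exact: sublevel_sperm|].
by apply/rowP => i; rewrite !mxE mulrDr.
Qed.

Lemma body_convex r :
  (forall x y t, 0 <= t <= 1 -> L x -> L y -> L (t *: x + (1 - t) *: y)) ->
  forall x y t, 0 <= t <= 1 -> body r x -> body r y -> body r (t *: x + (1 - t) *: y).
Proof.
move=> Lc x y t t01 [w [v [Lw cv ->]]] [w' [v' [Lw' cv' ->]]].
exists (t *: w + (1 - t) *: w'), (t *: v + (1 - t) *: v').
by split; [exact: Lc|exact: sublevel_convex|rewrite !scalerDr addrACA].
Qed.

Lemma body_open r : sup_open (body r).
Proof.
move=> z [w [v [Lw cv ->]]]; have [v1 vr] := cv.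
have eps0 : 0 < (r - Phi v) / 2 by rewrite divr_gt0// subr_gt0.
have [e e0 H] := sublevel_nbhd r eps0; exists e => // y yz.
exists w, (v + (y - (w + v))); split => //.
  have [] := H v (y - (w + v)) cv.
    by move=> i; rewrite mxE [X in _ + X]mxE ltW.
  by move=> o P; split => //; apply: le_lt_trans P _; lra.
by rewrite addrA addrC subrK.
Qed.

(** Moving one coordinate towards 0 by the amount at which phi equals j gains j in
Phi; the sign of the coordinate decides on the direction. *)
Lemma sublevel_pull r v i j : sublevel r v -> j%:R <= phi (v 0 i) ->
  sublevel (r - j%:R) (v - ((-1) ^+ (v 0 i < 0)%R * level j) *: delta_mx 0 i).
Proof.
move=> [v1 vr] jv; set a := level j; set b := (v 0 i < 0)%R.
have a0 : 0 <= a by exact: sqrtr_ge0.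
have av : a <= `|v 0 i| by exact: level_le.
have [b1 b2] := phi_superadd a0 av (v1 i).
set y := v - _.
have yi : y 0 i = (-1) ^+ b * (`|v 0 i| - a).
  by rewrite !mxE !eqxx mulr1 mulrBr -realEsign ?num_real.
have yk k : k != i -> y 0 k = v 0 k.
  by move=> ki; rewrite !mxE (negbTE ki) andbF mulr0 subr0.
have phi_sg (c : bool) u : phi ((-1) ^+ c * u) = phi u.
  by case: c; rewrite ?mulN1r ?phiN// expr0 mul1r.
have phi_abs u : phi `|u| = phi u by rewrite /phi real_normK ?num_real.
split => [k|].
  have [->|ki] := eqVneq k i; last by rewrite yk.
  by rewrite yi normrM normrX normrN1 expr1n mul1r.
move: vr; rewrite /Phi (bigD1 i)//= [X in _ -> X < _](bigD1 i)//= yi phi_sg.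
move: b2; rewrite phi_level phi_abs => b2.
under [X in _ -> _ + X < _]eq_bigr => k ki do rewrite yk//.
by move: b2; lra.
Qed.

End SmoothedBody.

(** * Averaging exit sets over levels and signed shifts *)

Section Averaging.
Context {R : realType}.

(** The mixed terms cancel in pairs: flipping the i-th sign changes the sign of
each of them. *)
Lemma sum_signs n (a : 'I_n -> R) :
  \sum_(s : {ffun 'I_n -> bool}) (\sum_i (-1) ^+ s i * a i) ^+ 2 = 2 ^+ n * \sum_i a i ^+ 2.
Proof.
pose f (s : {ffun 'I_n -> bool}) i j : R := ((-1) ^+ s i * a i) * ((-1) ^+ s j * a j).
have -> : \sum_(s : {ffun 'I_n -> bool}) (\sum_i (-1) ^+ s i * a i) ^+ 2 =
    \sum_i \sum_j \sum_(s : {ffun 'I_n -> bool}) f s i j.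
  under eq_bigr do rewrite expr2 mulr_suml.
  rewrite exchange_big; apply: eq_bigr => i _.
  under eq_bigr do rewrite mulr_sumr.
  by rewrite exchange_big.
rewrite mulr_sumr; apply: eq_bigr => i _.
rewrite (bigD1 i)//= [X in _ + X]big1 ?addr0 => [|j ji].
  under eq_bigr => s _ do rewrite /f -expr2 exprMn -exprM mulnC exprM sqrrN expr1n expr1n mul1r.
  by rewrite sumr_const card_ffun card_bool card_ord -[LHS]mulr_natl natrX.
pose flip (s : {ffun 'I_n -> bool}) := [ffun k => if k == i then ~~ s k else s k].
have flipK : involutive flip.
  by move=> s; apply/ffunP => k; rewrite !ffunE; case: eqP => //; rewrite negbK.
have : \sum_(s : {ffun 'I_n -> bool}) f s i j = - \sum_(s : {ffun 'I_n -> bool}) f s i j.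
  rewrite [LHS](reindex_inj (inv_inj flipK)) -sumrN; apply: eq_bigr => s _.
  by rewrite /f !ffunE eqxx (negbTE ji); case: (s i); rewrite /= ?expr0 ?expr1; ring.
by move=> h; lra.
Qed.

Context {m : nat}.
Notation n := m.+1.
Implicit Types x y z v w : 'rV[R]_n.

(** Signs and cyclic shifts: a set of signed permutations small enough for explicit
sums and large enough to make the second moments of g x isotropic. *)
Definition sgroup : finType := ({ffun 'I_n -> bool} * 'I_n)%type.

Definition act (g : sgroup) x := sperm g.1 (fun i => i + g.2) x.

Lemma card_sgroup : #|{: sgroup}|%:R = 2 ^+ n * n%:R :> R.
Proof. by rewrite card_prod card_ffun card_bool !card_ord natrM natrX. Qed.

Lemma dotp_act g x y : dotp (act g x) (act g y) = dotp x y.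
Proof.
rewrite [RHS]/dotp (reindex_inj (addIr g.2)); apply: eq_bigr => i _.
rewrite !mxE; case: (g.1 i); rewrite ?expr0 ?expr1; ring.
Qed.

Lemma sum_act y x : \sum_g dotp y (act g x) ^+ 2 = 2 ^+ n * (dotp y y * dotp x x).
Proof.
rewrite -(pair_bigA _ (fun s c => dotp y (act (s, c) x) ^+ 2)) /= exchange_big /=.
have -> : \sum_(c < n) \sum_(s : {ffun 'I_n -> bool}) dotp y (act (s, c) x) ^+ 2 =
   \sum_(c < n) 2 ^+ n * \sum_i (y 0 i * x 0 (i + c)) ^+ 2.
  apply: eq_bigr => c _; rewrite -sum_signs; apply: eq_bigr => s _; congr (_ ^+ 2).
  by apply: eq_bigr => i _; rewrite mxE /=; ring.
rewrite -mulr_sumr exchange_big /=; congr (_ * _).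
rewrite [dotp y y]/dotp mulr_suml; apply: eq_bigr => i _.
rewrite /dotp [in RHS](reindex_inj (addrI i)) mulr_sumr; apply: eq_bigr => c _.
by rewrite !expr2; ring.
Qed.

Lemma card_window N (P : pred 'I_N) (i1 : nat) (s X : R) : 0 <= X -> 1 + s <= X ->
  (forall i, P i -> (i1 <= i)%N /\ i%:R < i1%:R + s) -> #|P|%:R <= X.
Proof.
move=> X0 sX Pi; have [s0|s0] := ltP s 0.
  rewrite eq_card0// => i; apply/negbTE/negP => /Pi[i1i]; rewrite -(ler_nat R) in i1i.
  by lra.
apply: le_trans sX; pose M := (Num.truncn s).+1.
apply: (@le_trans _ _ M%:R); last by rewrite -natr1 addrC lerD2l truncn_le.
rewrite ler_nat cardE -(size_map val) -(size_iota i1 M); apply: uniq_leq_size.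
  by rewrite map_inj_uniq ?enum_uniq//; exact: val_inj.
move=> _ /mapP[i + ->]; rewrite mem_enum mem_iota => /Pi[-> i2] /=.
rewrite -(ltr_nat R) natrD; apply: lt_le_trans i2 _.
by rewrite lerD2l ltW// truncnS_gt.
Qed.

Context (L : set 'rV[R]_n) (k N : nat) (x : 'rV[R]_n) (h B e : R).
Context (xx : dotp x x = 1) (h0 : 0 < h) (he : h <= e)
  (hB : 2 * B * h <= 1) (hN : 1 <= N%:R * h).
Context (step : forall v (s : 'rV[R]_n), sublevel k.+1%:R v -> (forall i, `|s 0 i| <= e) ->
  open_cube (v + s) /\
  Phi (v + s) <= Phi v + \sum_i dphi (v 0 i) * s 0 i + B * \sum_i s 0 i ^+ 2).

Notation K := (body L).
(** N levels, equally spaced between k + 1/2 and k + 1. *)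
Definition height (i : nat) : R := k%:R + 2^-1 + i.+1%:R / (2 * N%:R).
Definition exitset (g : sgroup) (i : nat) := [set z | K (height i) z /\ ~ K (height i) (z + h *: act g x)].
(** A bound for the square of dphi where phi is between j and j + 1. *)
Definition weight (j : nat) : R := 64 * 16 ^+ j.
(** It contains the points w + v for which v has an l-th coordinate of sign b with
phi at least j. *)
Definition shifted (l : 'I_n) (j : nat) (b : bool) :=
  (fun y => y + ((-1) ^+ b * level j) *: delta_mx 0 l) @` K (k.+1 - j)%:R.

Lemma N_gt0 : 0 < N%:R :> R.
Proof. by rewrite ltr0n lt0n; apply: contraTneq hN => ->; rewrite mul0r -ltNge ltr01. Qed.

Lemma height_le i : (i < N)%N -> height i <= k.+1%:R.
Proof.
move=> iN; have N0 := N_gt0.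
rewrite /height -[leRHS]natr1 -addrA lerD2l -lerBrDl ler_pdivrMr ?mulr_gt0//.
rewrite (_ : (1 - 2^-1) * (2 * N%:R) = N%:R) ?ler_nat//.
by field.
Qed.

Lemma exit_sub g (i : 'I_N) : exitset g i `<=` K k.+1%:R.
Proof. by move=> z [zi _]; apply: body_le zi; exact: height_le. Qed.

(** Only the term with j the integer part of phi (v_l) and b the sign of v_l is
needed. *)
Lemma gradient_le w v : L w -> sublevel k.+1%:R v ->
  \sum_l dphi (v 0 l) ^+ 2 <=
  \sum_(l < n) \sum_(j < k.+1) \sum_(b : bool) weight j * \1_(shifted l j b) (w + v).
Proof.
move=> Lw cv; apply: ler_sum => l _; have [v1 vr] := cv.
have p0 := phi_ge0 (v1 l).
pose j := Num.truncn (phi (v 0 l)); pose b := v 0 l < 0.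
have /andP[j1 j2] := truncn_itv p0; rewrite -/j in j1 j2.
have jk : (j < k.+1)%N.
  rewrite -(ltr_nat R); apply: le_lt_trans j1 _.
  by apply: le_lt_trans (phi_le_Phi l v1) vr.
have term0 (j' : nat) b' : 0 <= weight j' * \1_(shifted l j' b') (w + v).
  by rewrite mulr_ge0// mulr_ge0// exprn_ge0.
rewrite (bigD1 (Ordinal jk))//= (bigD1 b)//= -addrA ler_wpDr//.
  by rewrite addr_ge0// sumr_ge0// => i _; rewrite sumr_ge0.
rewrite indicE mem_set.
  by rewrite mulr1; apply: dphi_le => //; rewrite natr1 ltW.
exists (w + (v - ((-1) ^+ b * level j) *: delta_mx 0 l)); last by rewrite -addrA subrK.
exists w, (v - ((-1) ^+ b * level j) *: delta_mx 0 l); split => //.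
rewrite natrB; last exact: ltnW.
exact: sublevel_pull.
Qed.

(** Let i1 be the first level whose body contains z, and z = w + v a decomposition
that shows it; it serves for all g at once. The levels at which z exits in the
direction g x start at i1 and end before Phi (v + h g x), so that there are at
most 1 + 2 N (h Y + B h^2) of them, where Y = <grad Phi v, g x>. With
2 Y <= 1 + Y^2 this is summed over g by means of [sum_act]. *)
Lemma exit_count z : K k.+1%:R z ->
  \sum_(g : sgroup) \sum_(i < N) \1_(exitset g i) z <=
  N%:R * h * #|{: sgroup}|%:R * (3 + n%:R^-1 *
    \sum_(l < n) \sum_(j < k.+1) \sum_(b : bool) weight j * \1_(shifted l j b) z).
Proof.
move=> Kz; have N0 := N_gt0; set T := \sum_(l < n) _.
have T0 : 0 <= T.
  by do 3 (apply: sumr_ge0 => ? _); rewrite mulr_ge0// mulr_ge0// exprn_ge0.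
have [[i Ki]|noK] := pselect (exists i : 'I_N, K (height i) z); last first.
  rewrite big1 => [|g _]; last first.
    apply: big1 => i _; rewrite indicE memNset// => -[Ki _].
    by apply: noK; exists i.
  by rewrite !mulr_ge0// ?(ltW h0)// addr_ge0// mulr_ge0.
have exi : exists i, (i < N)%N && `[< K (height i) z >].
  by exists i; rewrite ltn_ord; exact/asboolP.
case: (ex_minnP exi) => i1 /andP[i1N /asboolP[w [v [Lw cv1 zE]]]] i1min.
have cv : sublevel k.+1%:R v.
  by have [v1 vr] := cv1; split => //; apply: lt_le_trans vr (height_le i1N).
pose y : 'rV[R]_n := \row_i dphi (v 0 i).
have yy : dotp y y <= T.
  rewrite /T zE; apply: le_trans (gradient_le Lw cv); apply: ler_sum => l _.
  by rewrite mxE -expr2.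
have main g : \sum_(i < N) \1_(exitset g i) z <= N%:R * h * (3 + dotp y (act g x) ^+ 2).
  set Y := dotp y _.
  have -> : \sum_(i < N) \1_(exitset g i) z = #|[pred i : 'I_N | `[< exitset g i z >]]|%:R :> R.
    rewrite -sum1_card natr_sum [RHS]big_mkcond /=; apply: eq_bigr => j _.
    rewrite indicE (_ : (z \in exitset g j) = `[< exitset g j z >])//.
    by rewrite ?inE; case: `[< exitset g j z >].
  apply: (@card_window _ _ i1 (2 * N%:R * (h * Y + B * h ^+ 2))).
  - by rewrite !mulr_ge0// ?(ltW h0)// addr_ge0// sqr_ge0.
  - have hh : 2 * B * h * (N%:R * h) <= N%:R * h by rewrite ler_piMl// mulr_ge0// ltW.
    have Y2 : 2 * Y <= 1 + Y ^+ 2 by have := sqr_ge0 (1 - Y); rewrite sqrrB; lra.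
    have : N%:R * h * (2 * Y) <= N%:R * h * (1 + Y ^+ 2) by rewrite ler_pM2l// mulr_gt0.
    move: hh hN; rewrite expr2; move: (Y ^+ 2) => Y'; nra.
  move=> j /asboolP[Kj nKj]; split.
    by apply: i1min; rewrite ltn_ord; exact/asboolP.
  have [|o Phis] := step cv (s := h *: act g x).
    move=> l; rewrite mxE normrM (gtr0_norm h0); apply: le_trans he.
    rewrite ler_piMr ?(ltW h0)//; apply: le_trans (coord_le_euclid _ l) _.
    by rewrite /euclid_norm dotp_act xx sqrtr1.
  have lejPhi : height j <= Phi (v + h *: act g x).
    rewrite leNgt; apply/negP => lt; apply: nKj.
    by exists w, (v + h *: act g x); split => //; rewrite zE addrA.
  have [_ vlt] := cv1.
  have S1 : \sum_l dphi (v 0 l) * (h *: act g x) 0 l = h * Y.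
    by rewrite /Y /dotp mulr_sumr; apply: eq_bigr => l _; rewrite !mxE; ring.
  have S2 : \sum_l (h *: act g x) 0 l ^+ 2 = h ^+ 2.
    transitivity (h ^+ 2 * dotp (act g x) (act g x)); last by rewrite dotp_act xx mulr1.
    rewrite /dotp mulr_sumr; apply: eq_bigr => l _.
    by rewrite !mxE; ring.
  rewrite S1 S2 in Phis.
  have : height j < height i1 + (h * Y + B * h ^+ 2) by lra.
  rewrite /height -!addrA !ltrD2l -ltrBlDl -mulrBl ltr_pdivrMr ?mulr_gt0//.
  by rewrite -!natr1 mulrC => ?; lra.
apply: le_trans (ler_sum _ (fun g _ => main g)) _.
rewrite -mulr_sumr -mulrA ler_pM2l ?mulr_gt0//.
rewrite big_split /= sumr_const sum_act xx mulr1 mulrDr.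
apply: lerD; first by rewrite -[leLHS]mulr_natl.
rewrite card_sgroup -mulrA ler_pM2l ?exprn_gt0// mulrA divff ?mul1r//.
Qed.

Context (bL : bounded L).

Lemma body_is_bounded r : bounded (K r).
Proof. by have [D LD] := bL; exists (D + 1) => z i; exact: body_bounded. Qed.

Lemma sup_open_shift (G : set 'rV[R]_n) v : sup_open G -> sup_open [set z | G (z + v)].
Proof.
move=> oG z /oG[d d0 Gd]; exists d => // y yz; apply: Gd => i.
by rewrite !mxE opprD addrACA subrr addr0; exact: yz.
Qed.

Lemma exitset_caratheodory g i : (@hausdorff_measure R n n).-caratheodory (exitset g i).
Proof.
have -> : exitset g i = K (height i) `&` ~` [set z | K (height i) (z + h *: act g x)] by [].
apply: caratheodory_measurable_setI; first exact/sup_open_caratheodory/body_open.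
apply: caratheodory_measurable_setC; apply: sup_open_caratheodory.
exact/sup_open_shift/body_open.
Qed.

Lemma shifted_caratheodory l j b : (@hausdorff_measure R n n).-caratheodory (shifted l j b).
Proof.
have -> : shifted l j b =
    [set z | K (k.+1 - j)%:R (z + - (((-1) ^+ b * level j) *: delta_mx 0 l))].
  rewrite predeqE => z; split => [[y Ky <-]|Kz] /=; first by rewrite addrK.
  by eexists; [exact: Kz|rewrite subrK].
exact/sup_open_caratheodory/sup_open_shift/body_open.
Qed.

Lemma hmeas_caratheodory (A Y : set 'rV[R]_n) : bounded Y ->
  (@hausdorff_measure R n n).-caratheodory A ->
  hmeas n Y = hmeas n (Y `&` A) + hmeas n (Y `&` ~` A).
Proof.
move=> bY cA; apply: EFin_inj; rewrite EFinD -!hmeasE//.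
- by apply: boundedS bY => z [].
- by apply: boundedS bY => z [].
Qed.

(** The inequality of [exit_count], integrated over body k.+1. *)
Lemma exit_measure :
  \sum_(g : sgroup) \sum_(i < N) hmeas n (exitset g i) <=
  N%:R * h * #|{: sgroup}|%:R * (3 * hmeas n (K k.+1%:R) + n%:R^-1 *
    \sum_(l < n) \sum_(j < k.+1) \sum_(b : bool) weight j * hmeas n (K (k.+1 - j)%:R)).
Proof.
pose I : finType := (sgroup * 'I_N + 'I_n * ('I_k.+1 * bool))%type.
pose A (i : I) := match i with
  | inl gi => exitset gi.1 gi.2 | inr ljb => shifted ljb.1 ljb.2.1 ljb.2.2 end.
pose C := N%:R * h * #|{: sgroup}|%:R.
pose c (i : I) := match i with inl _ => -1 | inr ljb => C * (n%:R^-1 * weight ljb.2.1) end.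
have sumI (F : I -> R) : \sum_(i <- index_enum I) F i =
    \sum_(g : sgroup) \sum_(i < N) F (inl (g, i)) +
    \sum_(l < n) \sum_(j < k.+1) \sum_(b : bool) F (inr (l, (j, b))).
  rewrite big_sumType /=; congr (_ + _).
    by rewrite (pair_bigA _ (fun g i => F (inl (g, i)))); apply: eq_bigr => -[].
  under [RHS]eq_bigr => l _ do rewrite (pair_bigA _ (fun j b => F (inr (l, (j, b))))).
  rewrite (pair_bigA _ (fun l (jb : 'I_k.+1 * bool) => F (inr (l, (jb.1, jb.2))))).
  by apply: eq_bigr => -[l [j b]].
have bK := body_is_bounded k.+1%:R.
have C0 : 0 <= C by rewrite !mulr_ge0// ltW.
have hmeas0 : hmeas n (set0 : set 'rV[R]_n) = 0 by rewrite /hmeas hausdorff0.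
have add i Y : Y `<=` K k.+1%:R -> hmeas n Y = hmeas n (Y `&` A i) + hmeas n (Y `&` ~` A i).
  move=> YK; apply: hmeas_caratheodory; first exact: boundedS YK bK.
  by case: i => [[g i]|[l [j b]]]; [exact: exitset_caratheodory|exact: shifted_caratheodory].
have pos z : K k.+1%:R z -> 0 <= C * 3 + \sum_(i <- index_enum I) c i * \1_(A i) z.
  move=> Kz; rewrite sumI /=; have := exit_count Kz; rewrite -/C mulrDr.
  under [X in _ -> _ <= _ + (X + _)]eq_bigr => g _ do
    (under eq_bigr => i _ do rewrite mulN1r; rewrite sumrN).
  rewrite sumrN mulrA mulr_sumr.
  rewrite [X in _ <= _ + X -> _](_ : _ =
    \sum_(l < n) \sum_(j < k.+1) \sum_(b : bool) C * (n%:R^-1 * weight j) * \1_(shifted l j b) z).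
    by lra.
  apply: eq_bigr => l _; rewrite mulr_sumr; apply: eq_bigr => j _; rewrite mulr_sumr.
  by apply: eq_bigr => b _; rewrite !mulrA.
have := nonneg_combination hmeas0 (hmeas_ge0 _) add pos; rewrite sumI /=.
have -> : \sum_(g : sgroup) \sum_(i < N) (-1) * hmeas n (K k.+1%:R `&` exitset g i) =
    - \sum_(g : sgroup) \sum_(i < N) hmeas n (exitset g i).
  rewrite -sumrN; apply: eq_bigr => g _; rewrite -sumrN; apply: eq_bigr => i _.
  by rewrite mulN1r setIidr//; exact: exit_sub.
have : \sum_(l < n) \sum_(j < k.+1) \sum_(b : bool)
      C * (n%:R^-1 * weight j) * hmeas n (K k.+1%:R `&` shifted l j b) <=
    C * (n%:R^-1 * \sum_(l < n) \sum_(j < k.+1) \sum_(b : bool) weight j * hmeas n (K (k.+1 - j)%:R)).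
  rewrite mulrA mulr_sumr; apply: ler_sum => l _; rewrite mulr_sumr; apply: ler_sum => j _.
  rewrite mulr_sumr; apply: ler_sum => b _.
  have w0 : 0 <= C * (n%:R^-1 * weight j).
    by apply: mulr_ge0 => //; apply: mulr_ge0; rewrite ?invr_ge0// mulr_ge0// exprn_ge0.
  apply: le_trans (ler_wpM2l w0 (_ : _ <= hmeas n (K (k.+1 - j)%:R))) _; last by rewrite !mulrA.
  rewrite -(hmeas_translate (((-1) ^+ b * level j) *: delta_mx 0 l) (K (k.+1 - j)%:R)).
  apply: le_hmeas; first by move=> z [].
  exact/bounded_translate/body_is_bounded.
move=> h1 h2; have := le_trans h2 (lerD (lexx _) (lerD (lexx _) h1)).
rewrite addrCA addrC subr_ge0 => h3; apply: le_trans h3 _.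
by rewrite -/C [leRHS]mulrDr [C * (3 * _)]mulrA.
Qed.

End Averaging.

(** * The gauge of a convex body *)

Section Gauge.
Context {R : realType} {n : nat}.
Context (K : set 'rV[R]_n).
Context
  (Kconv : forall x y t, 0 <= t <= 1 -> K x -> K y -> K (t *: x + (1 - t) *: y))
  (KN : forall x, K x -> K (- x))
  (Kcube : forall x : 'rV[R]_n, (forall i, `|x 0 i| <= 1) -> K x)
  (bK : bounded K).
Implicit Types (x y z : 'rV[R]_n) (s t : R).

Definition scalings z : set R := [set s | 0 < s /\ K (s^-1 *: z)].
Definition gauge z : R := inf (scalings z).

Lemma scalings_lbound z : lbound (scalings z) 0.
Proof. by move=> s [/ltW]. Qed.

Lemma scalings_neq0 z : scalings z !=set0.
Proof.
have s0 : 0 < 1 + \sum_i `|z 0 i| by rewrite ltr_pwDl// sumr_ge0.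
exists (1 + \sum_i `|z 0 i|); split => //; apply: Kcube => i.
rewrite mxE normrM (gtr0_norm _) ?invr_gt0// ler_pdivrMl// mulr1.
by rewrite ler_wpDl// (bigD1 i)//= lerDl sumr_ge0.
Qed.

Lemma scalings_has_inf z : has_inf (scalings z).
Proof. by split; [exact: scalings_neq0|exists 0; exact: scalings_lbound]. Qed.

Lemma gauge_le s z : 0 < s -> K (s^-1 *: z) -> gauge z <= s.
Proof. by move=> s0 Ks; apply: ge_inf; [exists 0; exact: scalings_lbound|split]. Qed.

Lemma gauge_ge0 z : 0 <= gauge z.
Proof. by apply: lb_le_inf; [exact: scalings_neq0|exact: scalings_lbound]. Qed.

Lemma gauge_body0 : K 0.
Proof. by apply: Kcube => i; rewrite mxE normr0. Qed.

Lemma gauge_lt s z : gauge z < s -> K (s^-1 *: z).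
Proof.
move=> zs; have e0 : 0 < s - gauge z by rewrite subr_gt0.
have [t [t0 Kt] ts] := inf_adherent e0 (scalings_has_inf z).
rewrite -/(gauge z) addrC subrK in ts.
have s0 : 0 < s by exact: lt_trans ts.
have -> : s^-1 *: z = (t / s) *: (t^-1 *: z) + (1 - t / s) *: 0.
  by rewrite scaler0 addr0 scalerA mulrAC divff ?gt_eqF// mul1r.
apply: Kconv => //; last exact: gauge_body0.
by rewrite divr_ge0 ?(ltW t0) ?(ltW s0)//= ler_pdivrMr// mul1r ltW.
Qed.

(** The form in which upper bounds for the gauge are proved, since the infimum need
not be attained. *)
Lemma gauge_le_all (c : R) z : (forall s, c < s -> K (s^-1 *: z)) -> 0 <= c -> gauge z <= c.
Proof.
move=> H c0; rewrite leNgt; apply/negP => lt.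
have h1 : c < (c + gauge z) / 2 by rewrite ltr_pdivlMr// mulr_natr mulr2n ltrD2l.
have h2 : (c + gauge z) / 2 < gauge z by rewrite ltr_pdivrMr// mulr_natr mulr2n ltrD2r.
have := gauge_le (le_lt_trans c0 h1) (H _ h1).
by rewrite leNgt h2.
Qed.

Lemma gauge_norm : is_norm gauge.
Proof.
split.
- move=> x y; apply: gauge_le_all; last by rewrite addr_ge0// gauge_ge0.
  move=> s xys; pose e := (s - (gauge x + gauge y)) / 2.
  have e0 : 0 < e by rewrite divr_gt0// subr_gt0.
  have a0 : 0 < gauge x + e by rewrite ltr_wpDl// gauge_ge0.
  have b0 : 0 < gauge y + e by rewrite ltr_wpDl// gauge_ge0.
  have sE : s = (gauge x + e) + (gauge y + e) by rewrite /e; field.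
  have s0 : 0 < s by rewrite sE addr_gt0.
  have Kx : K ((gauge x + e)^-1 *: x) by apply: gauge_lt; rewrite ltrDl.
  have Ky : K ((gauge y + e)^-1 *: y) by apply: gauge_lt; rewrite ltrDl.
  have -> : s^-1 *: (x + y) = ((gauge x + e) / s) *: ((gauge x + e)^-1 *: x) +
      (1 - (gauge x + e) / s) *: ((gauge y + e)^-1 *: y).
    have -> : 1 - (gauge x + e) / s = (gauge y + e) / s.
      by rewrite -[X in X - _](divff (lt0r_neq0 s0)) -mulrBl {1}sE addrC addKr.
    rewrite !scalerA scalerDr; congr (_ *: _ + _ *: _).
      by rewrite mulrAC divff ?mul1r// gt_eqF.
    by rewrite mulrAC divff ?mul1r// gt_eqF.
  apply: Kconv => //; rewrite divr_ge0 ?(ltW a0) ?(ltW s0)//= ler_pdivrMr// mul1r sE.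
  by rewrite lerDl ltW.
- have sub a x : a != 0 -> gauge (a *: x) <= `|a| * gauge x.
    move=> a0; have na0 : 0 < `|a| by rewrite normr_gt0.
    apply: gauge_le_all; last by rewrite mulr_ge0// gauge_ge0.
    move=> s; rewrite -ltr_pdivlMl// => /gauge_lt; rewrite invfM invrK scalerA.
    have [a1|a1] := leP 0 a; first by rewrite ger0_norm// (mulrC a).
    by rewrite ltr0_norm// mulNr scaleNr => /KN; rewrite opprK (mulrC a).
  move=> a x; have [->|a0] := eqVneq a 0.
    rewrite scale0r normr0 mul0r; apply/eqP; rewrite eq_le gauge_ge0 andbT.
    by apply: gauge_le_all => // s s0; rewrite scaler0; exact: gauge_body0.
  apply/eqP; rewrite eq_le sub//=.
  have := sub a^-1 (a *: x); rewrite invr_eq0 => /(_ a0).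
  rewrite scalerA mulVf// scale1r normfV.
  by rewrite ler_pdivlMl ?normr_gt0.
- move=> x gx0; have [D KD] := bK; apply/rowP => i; rewrite mxE.
  have D0 : 0 <= D by apply: le_trans (KD _ i gauge_body0).
  apply/eqP; rewrite -normr_le0; apply/ler_addgt0Pr => e e0; rewrite add0r.
  pose s := e / (D + 1).
  have D1 : 0 < D + 1 by rewrite ltr_wpDl.
  have s0 : 0 < s by rewrite divr_gt0.
  have := KD _ i (gauge_lt (_ : gauge x < s)); rewrite gx0 => /(_ s0).
  rewrite mxE normrM (gtr0_norm _) ?invr_gt0// ler_pdivrMl// => h.
  apply: le_trans h _; rewrite /s mulrAC ler_pdivrMr//.
  by rewrite ler_pM2l// lerDl.
Qed.

End Gauge.

(** * Choice of the level *)

Section ChooseLevel.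
Context {R : realType}.

(** A level at which V k / 32 ^+ k is at least half of its supremum. It is not 0,
because V vanishes there while the supremum is positive. *)
Lemma near_maximal_level (V : nat -> R) (M : R) : (forall k, V k <= M) -> V 0%N = 0 ->
  (forall k, 0 <= V k) -> 0 < V 1%N ->
  exists2 k, (0 < k)%N & forall k', V k' <= 2 * (32 ^+ k' / 32 ^+ k) * V k.
Proof.
move=> VM V0 Vge0 V1; pose f k := V k / 32 ^+ k.
have p32 k : 0 < 32 ^+ k :> R by rewrite exprn_gt0.
have hsup : has_sup (range f).
  split; first by exists (f 0%N); exists 0%N.
  exists M => _ [k _ <-]; rewrite /f ler_pdivrMr//; apply: le_trans (VM k) _.
  by rewrite ler_peMr ?exprn_ege1// ?ler1n// (le_trans (Vge0 k)).
have fsup k : f k <= sup (range f) by apply: sup_upper_bound => //; exists k.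
have S0 : 0 < sup (range f) by apply: lt_le_trans (fsup 1%N); rewrite divr_gt0.
have half0 : 0 < sup (range f) / 2 by rewrite divr_gt0.
have [_ [k _ <-] fk] := sup_adherent half0 hsup.
have fk2 : sup (range f) < 2 * f k by lra.
exists k.
  rewrite lt0n; apply/eqP => k0; move: fk2.
  by rewrite k0 /f V0 mul0r mulr0 => /(lt_trans S0); rewrite ltxx.
move=> k'; have := le_trans (fsup k') (ltW fk2).
rewrite {1}/f ler_pdivrMr// => h; apply: le_trans h _.
by rewrite /f le_eqVlt; apply/orP; left; apply/eqP; field; rewrite gt_eqF.
Qed.

Lemma geometric_sum_le k : \sum_(j < k) (2^-1 : R) ^+ j <= 2.
Proof.
suff -> : \sum_(j < k) (2^-1 : R) ^+ j = 2 - 2 * 2^-1 ^+ k.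
  by rewrite lerBlDr lerDl mulr_ge0// exprn_ge0.
elim: k => [|k ih]; first by rewrite big_ord0 expr0; lra.
by rewrite big_ord_recr /= ih exprS; field.
Qed.

End ChooseLevel.

(** * Shadows of the rounded body *)

Section SmoothedUnitBall.
Context {R : realType} {m : nat}.
Notation n := m.+1.
Context (L : set 'rV[R]_n).
Context
  (Lconv : forall x y t, 0 <= t <= 1 -> L x -> L y -> L (t *: x + (1 - t) *: y))
  (Lsym : forall s p x, injective p -> L x -> L (sperm s p x))
  (Lcube : forall x : 'rV[R]_n, (forall i, `|x 0 i| <= 1) -> L x)
  (bL : bounded L).
Notation K r := (body L r).
Implicit Types (x y z w v : 'rV[R]_n).

Lemma body_opp r z : K r z -> K r (- z).
Proof.
move=> Kz; have -> : - z = sperm (fun=> true) id z.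
  by apply/rowP => i; rewrite !mxE mulN1r.
by apply: body_sperm => // x; exact: Lsym.
Qed.

Lemma body_cube r : 0 < r -> forall z, (forall i, `|z 0 i| <= 1) -> K r z.
Proof. by move=> r0 z z1; apply: sub_body => //; exact: Lcube. Qed.

Lemma gauge_act r g z : 0 < r -> gauge (K r) z <= 1 -> gauge (K r) (act g z) <= 1.
Proof.
move=> r0 z1; apply: gauge_le_all => // s s1.
have -> : s^-1 *: act g z = act g (s^-1 *: z) by apply/rowP => i; rewrite !mxE; ring.
apply: body_sperm; first by move=> x; apply: Lsym; exact: addIr.
  exact: addIr.
apply: gauge_lt; last exact: le_lt_trans s1.
- exact: body_convex.
- exact: body_cube.
Qed.

Lemma proj_act g x z : proj_perp (act g x) (act g z) = act g (proj_perp x z).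
Proof.
rewrite /proj_perp !dotp_act; apply/rowP => i; rewrite !mxE; ring.
Qed.

(** The isometry act g maps the shadow of B along x into the shadow of act g @` B
along act g x. *)
Lemma hmeas_proj_act (B : set 'rV[R]_n) g x : dotp x x = 1 -> bounded B ->
  (forall z, B z -> B (act g z)) ->
  hmeas m (proj_perp x @` B) <= hmeas m (proj_perp (act g x) @` B).
Proof.
move=> xx bB gB.
have -> : hmeas m (proj_perp x @` B) = hmeas m (act g @` (proj_perp x @` B)).
  apply: hmeas_eq; rewrite [RHS](@hausdorff_similarity _ _ _ _ _ 1)// ?expr1n ?mul1e// => y z _ _.
  have -> : act g y - act g z = act g (y - z) by apply/rowP => i; rewrite !mxE; ring.
  by rewrite mul1r /euclid_norm dotp_act.
have fin x' : dotp x' x' = 1 -> (hausdorff_measure m (proj_perp x' @` B) \is a fin_num).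
  by move=> xx'; rewrite ge0_fin_numE ?hausdorff_ge0// hausdorff_proj_fin.
have le : (hausdorff_measure m (act g @` (proj_perp x @` B)) <=
           hausdorff_measure m (proj_perp (act g x) @` B))%E.
  apply: le_hausdorff => _ [_ [z Bz <-] <-]; exists (act g z); first exact: gB.
  exact: proj_act.
have finG := fin _ (etrans (dotp_act g x x) xx).
apply: fine_le => //; rewrite ge0_fin_numE ?hausdorff_ge0//.
by apply: le_lt_trans le _; rewrite -ge0_fin_numE ?hausdorff_ge0.
Qed.

(** The closed unit ball of the gauge lies in (1 + d) times the body; moving its
points a little raises Phi by at most 1/4. *)
Lemma unit_ball_nbhd (k : nat) : (0 < k)%N -> exists2 e : R, 0 < e &
  forall z y, gauge (K k%:R) z <= 1 -> (forall i, `|y 0 i - z 0 i| <= e) ->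
    K (k%:R + 2^-1) y.
Proof.
move=> k0; have q0 : 0 < 4^-1 :> R by [].
have [e e0 He] := sublevel_nbhd (n := n) k%:R q0.
have [D LD] := bL; have D0 : 0 <= D.
  by apply: le_trans (LD 0 ord0 _) => //; apply: Lcube => i; rewrite mxE normr0.
have kR : 0 < k%:R :> R by rewrite ltr0n.
have D1 : 0 < D + 1 by rewrite ltr_wpDl.
pose d := e / (2 * (D + 1)).
have d0 : 0 < d by rewrite divr_gt0// mulr_gt0.
exists (e / 2) => [|z y z1 yz]; first by rewrite divr_gt0.
have : K k%:R ((1 + d)^-1 *: z).
  apply: gauge_lt; last by apply: le_lt_trans z1 _; rewrite ltrDl.
  - exact: body_convex.
  - exact: body_cube.
move=> Kz; have Dz i := body_bounded LD i Kz.
case: Kz => w [v [Lw cv zE]].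
have {}zE : z = (1 + d) *: (w + v).
  by rewrite -zE scalerA divff ?scale1r// gt_eqF// addr_gt0.
exists w, (v + (y - (w + v))); split => //; last by rewrite addrA addrC subrK.
have [i|o P] := He v (y - (w + v)) cv; last by split=> //; have [_ vr] := cv; lra.
have -> : (y - (w + v)) 0 i = (y 0 i - z 0 i) + d * (w 0 i + v 0 i).
  by rewrite zE !mxE; ring.
apply: le_trans (ler_normD _ _) _; rewrite [leRHS](splitr e); apply: lerD; first exact: yz.
rewrite normrM gtr0_norm//.
have := Dz i; rewrite zE scalerA mulVf ?scale1r ?mxE => [h|]; last by rewrite gt_eqF// addr_gt0.
apply: (@le_trans _ _ (d * (D + 1))); first by rewrite ler_pM2l.
by rewrite /d le_eqVlt; apply/orP; left; apply/eqP; field; rewrite gt_eqF.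
Qed.

(** The growth 16^j of the weights is beaten by the decay 32^-j of the volumes. *)
Lemma level_sum_le (k : nat) (V : nat -> R) :
  (forall k', V k' <= 2 * (32 ^+ k' / 32 ^+ k) * V k) -> 0 <= V k ->
  \sum_(l < n) \sum_(j < k.+1) \sum_(b : bool) weight j * V (k.+1 - j)%N <=
  n%:R * (128 * (128 * V k)).
Proof.
move=> Vle V0; have p32 j : 0 < 32 ^+ j :> R by rewrite exprn_gt0.
have -> : n%:R * (128 * (128 * V k)) = \sum_(l < n) 128 * (128 * V k).
  by rewrite sumr_const card_ord -[RHS]mulr_natl.
apply: ler_sum => l _.
apply: (@le_trans _ _ (\sum_(j < k.+1) 64 * (128 * V k) * 2^-1 ^+ j)); last first.
  rewrite -mulr_sumr [leRHS](_ : _ = 64 * (128 * V k) * 2); last by ring.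
  by apply: ler_wpM2l; [rewrite !mulr_ge0|exact: geometric_sum_le].
apply: ler_sum => j _; rewrite sumr_const card_bool -[leLHS]mulr_natl.
have jk : (j <= k.+1)%N by rewrite ltnW.
have := Vle (k.+1 - j)%N.
have -> : 32 ^+ (k.+1 - j) = 32 * 32 ^+ k / 32 ^+ j :> R.
  by rewrite -exprS; apply: (canRL (mulfK _)); rewrite ?gt_eqF// -exprD subnK.
have -> : 2 * (32 * 32 ^+ k / 32 ^+ j / 32 ^+ k) * V k = 64 / 32 ^+ j * V k.
  by field; rewrite !gt_eqF.
move=> h; apply: (@le_trans _ _ (2 * (weight j * (64 / 32 ^+ j * V k)))).
  by rewrite ler_pM2l// ler_pM2l// /weight mulr_gt0// exprn_gt0.
rewrite /weight (_ : 32 = 16 * 2 :> R); last by rewrite -natrM.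
rewrite exprMn exprVn le_eqVlt; apply/orP; left; apply/eqP; field.
by rewrite !gt_eqF ?exprn_gt0.
Qed.

(** 4 from [sweep], 3 * 64 from the constant term of [exit_measure] and the growth
of the volume from level k to level k.+1, 128 * 128 from [level_sum_le]. *)
Definition isoconst : R := 4 * (3 * 64 + 128 * 128).

Theorem smoothed_unit_ball : exists N : 'rV[R]_n -> R, [/\ is_norm N, bounded (unit_ball N),
  forall x, L x -> N x <= 1,
  forall x, N x < 1 -> exists w v, [/\ L w, open_cube v & x = w + v] &
  forall x, dotp x x = 1 ->
    hmeas m (proj_perp x @` unit_ball N) * kappa n <= isoconst * kappa m * hmeas n (unit_ball N)].
Proof.
have [D LD] := bL.
have bK r : bounded (K r) by exists (D + 1) => z i; exact: body_bounded.
pose V (k : nat) := hmeas n (K k%:R).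
have [k k0 Vk] : exists2 k, (0 < k)%N & forall k', V k' <= 2 * (32 ^+ k' / 32 ^+ k) * V k.
  apply: (@near_maximal_level _ V (hmeas n (box (const_mx (- (D + 1)) : 'rV[R]_n) (2 * (D + 1))))).
  - move=> j; apply: le_hmeas; last exact: bounded_box.
    move=> z Kz i; have := body_bounded LD i Kz; rewrite mxE ler_norml => /andP[? ?].
    by apply/andP; split; lra.
  - by rewrite /V body0 /hmeas hausdorff0.
  - by move=> j; exact: hmeas_ge0.
  - apply: lt_le_trans (kappa_gt0 n) _; apply: le_hmeas => // z z01.
    apply: body_cube => // i; have /andP[z0 z1] := z01 i.
    by rewrite ger0_norm.
have kR : 0 < k%:R :> R by rewrite ltr0n.
have cvx : forall x y t, 0 <= t <= 1 -> K k%:R x -> K k%:R y -> K k%:R (t *: x + (1 - t) *: y).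
  exact: body_convex.
have Kc := body_cube kR.
pose N := gauge (K k%:R).
have KB : K k%:R `<=` unit_ball N.
  by move=> z Kz; apply: gauge_le => //; rewrite invr1 scale1r.
have [e e0 near] := unit_ball_nbhd k0.
have bB : bounded (unit_ball N).
  apply: (boundedS _ (bK (k%:R + 2^-1))) => z z1; apply: near z1 _ => i.
  by rewrite subrr normr0 ltW.
exists N; split => //.
- exact: gauge_norm cvx (@body_opp _) Kc (bK _).
- by move=> x Lx; apply: KB; exact: sub_body.
- move=> x /(gauge_lt cvx Kc); rewrite invr1 scale1r => -[w [v [Lw [v1 _] xE]]].
  by exists w, v.
move=> x xx.
have [B [e1 [B0 e10 step]]] := sublevel_step (n := n) (k.+1%:R : R).
(* h is small enough for sweeping, for the expansion of Phi, and for its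
   quadratic term to be dominated by the linear one. *)
pose h := Num.min (Num.min (e / n%:R) e1) (2 * B + 1)^-1.
have B1 : 0 < 2 * B + 1 by rewrite ltr_wpDl// mulr_ge0.
have h0 : 0 < h by rewrite !lt_min e10 divr_gt0//= invr_gt0.
have hn : n%:R * h <= e by rewrite mulrC -ler_pdivlMr// !ge_min lexx.
have he : h <= e1 by rewrite !ge_min lexx orbT.
have hB : 2 * B * h <= 1.
  apply: (@le_trans _ _ (2 * B * (2 * B + 1)^-1)).
    by rewrite ler_wpM2l ?mulr_ge0// !ge_min lexx orbT.
  by rewrite ler_pdivrMr// mul1r lerDl.
(* With M h >= 1, rounding the number of levels up is harmless. *)
pose M := (Num.truncn h^-1).+1.
have hM : 1 <= M%:R * h by rewrite -ler_pdivrMr// div1r ltW// truncnS_gt.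
have main := exit_measure xx h0 he hB hM step bL.
pose P := hmeas m (proj_perp x @` unit_ball N).
have lower g (i : 'I_M) : h * P * kappa n <= 4 * kappa m * hmeas n (exitset L k M x h g i).
  apply: le_trans (sweep (t := e) (S := unit_ball N) _ (bK _) h0 hn _).
  - rewrite ler_pM2r ?kappa_gt0// ler_pM2l//; apply: hmeas_proj_act => // z.
    exact: gauge_act.
  - by rewrite dotp_act.
  - move=> s y Bs ys; apply: (body_le _ (near _ _ Bs ys)).
    by rewrite /height lerDl divr_ge0// mulr_ge0.
have G0 : 0 < #|{: sgroup (m := m)}|%:R :> R by rewrite (card_sgroup (R := R)) mulr_gt0// exprn_gt0.
have km := kappa_gt0 (R := R) m; have kn := kappa_gt0 (R := R) n.
have M0 : 0 < M%:R :> R by [].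
have V0 : 0 <= V k by exact: hmeas_ge0.
have total : #|{: sgroup (m := m)}|%:R * (M%:R * (h * P * kappa n)) <=
    4 * kappa m * \sum_(g : sgroup) \sum_(i < M) hmeas n (exitset L k M x h g i).
  rewrite mulr_sumr; apply: (@le_trans _ _ (\sum_(g : sgroup (m := m)) M%:R * (h * P * kappa n))).
    by rewrite sumr_const -[leRHS]mulr_natl.
  apply: ler_sum => g _; rewrite mulr_sumr.
  apply: (@le_trans _ _ (\sum_(i < M) h * P * kappa n)).
    by rewrite sumr_const card_ord -[leRHS]mulr_natl.
  by apply: ler_sum => i _; exact: lower.
have upper : 3 * hmeas n (K k.+1%:R) + n%:R^-1 *
    \sum_(l < n) \sum_(j < k.+1) \sum_(b : bool) weight j * hmeas n (K (k.+1 - j)%:R) <= (3 * 64 + 128 * 128) * V k.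
  have h1 : hmeas n (K k.+1%:R) <= 64 * V k.
    apply: le_trans (Vk k.+1) _; rewrite exprS mulfK ?gt_eqF ?exprn_gt0//.
    by rewrite le_eqVlt; apply/orP; left; apply/eqP; ring.
  have h2 := level_sum_le Vk V0.
  have h3 : n%:R^-1 * (\sum_(l < n) \sum_(j < k.+1) \sum_(b : bool) weight j * hmeas n (K (k.+1 - j)%:R))
     <= 128 * (128 * V k) by rewrite ler_pdivrMl//.
  have three0 : 0 <= 3 :> R by [].
  apply: le_trans (lerD (ler_wpM2l three0 h1) h3) _.
  by rewrite le_eqVlt; apply/orP; left; apply/eqP; ring.
have fin : M%:R * h * #|{: sgroup (m := m)}|%:R * (P * kappa n) <=
    M%:R * h * #|{: sgroup (m := m)}|%:R * (isoconst * kappa m * V k).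
  apply: (@le_trans _ _ (4 * kappa m * (M%:R * h * #|{: sgroup (m := m)}|%:R * ((3 * 64 + 128 * 128) * V k)))).
    rewrite (_ : M%:R * h * #|{: sgroup (m := m)}|%:R * (P * kappa n) =
      #|{: sgroup (m := m)}|%:R * (M%:R * (h * P * kappa n))); last by ring.
    apply: le_trans total _; rewrite ler_pM2l ?mulr_gt0//; apply: le_trans main _.
    by rewrite ler_pM2l ?mulr_gt0.
  by rewrite le_eqVlt /isoconst; apply/orP; left; apply/eqP; ring.
rewrite ler_pM2l ?mulr_gt0// in fin; apply: le_trans fin _.
by apply: ler_wpM2l; [rewrite !mulr_ge0// ltW|exact: le_hmeas].
Qed.

End SmoothedUnitBall.

(** * The l_p norm *)

Section LpNorm.
Context {R : realType} {n : nat}.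
Implicit Types (x y : 'rV[R]_n) (p : \bar R).

Lemma lp_norm_ge0 p x : 0 <= lp_norm p x.
Proof. by case: p => [r| |] /=; [exact: powR_ge0|exact: bigmax_ge_id|exact: bigmax_ge_id]. Qed.

Lemma coord_le_lp p x i : (1 <= p)%E -> `|x 0 i| <= lp_norm p x.
Proof.
case: p => [r| |] //=; last by move=> _; exact: le_bigmax.
rewrite lee_fin => r1; have r0 : 0 < r by exact: lt_le_trans r1.
rewrite -[leLHS]powRr1// -[X in _ `^ X](@mulfV _ r) ?gt_eqF// powRrM.
apply: ge0_ler_powR; rewrite ?invr_ge0 ?(ltW r0) ?nnegrE ?powR_ge0//.
  by apply: sumr_ge0 => j _; exact: powR_ge0.
by rewrite (bigD1 i)//= lerDl; apply: sumr_ge0 => j _; exact: powR_ge0.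
Qed.

Lemma lp_normZ p (a : R) x : (1 <= p)%E -> lp_norm p (a *: x) = `|a| * lp_norm p x.
Proof.
case: p => [r| |] //=.
  rewrite lee_fin => r1; have r0 : 0 < r by exact: lt_le_trans r1.
  under eq_bigr do rewrite mxE normrM powRM//.
  rewrite -mulr_sumr powRM ?powR_ge0//; last by apply: sumr_ge0 => j _; exact: powR_ge0.
  by rewrite -powRrM mulfV ?gt_eqF// powRr1.
move=> _; under eq_bigr do rewrite mxE normrM.
elim/big_ind2: _ => [|u v w z -> ->|//]; first by rewrite mulr0.
by rewrite maxr_pMr.
Qed.

Lemma lp_norm_sperm p s (q : 'I_n -> 'I_n) x : injective q -> (1 <= p)%E ->
  lp_norm p (sperm s q x) = lp_norm p x.
Proof.
move=> qinj; have abs i : `|sperm s q x 0 i| = `|x 0 (q i)|.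
  by rewrite mxE normrM normrX normrN1 expr1n mul1r.
by case: p => [r| |] _ /=; rewrite [in RHS](reindex_inj qinj); under eq_bigr do rewrite abs.
Qed.

(** The l_p norm of the vector of ones. *)
Definition ones_norm p : R := n%:R `^ fine (p^-1)%E.

(** The condition on the right has no outer root, which makes convexity visible. *)
Lemma lp_norm_le_ones p x : (1 <= p)%E -> (0 < n)%N ->
  lp_norm p x <= ones_norm p <->
  match p with r%:E => \sum_i `|x 0 i| `^ r <= n%:R | _ => forall i, `|x 0 i| <= 1 end.
Proof.
case: p => [r| |] //=; rewrite /ones_norm.
  rewrite lee_fin => r1 n0; have r0 : 0 < r by exact: lt_le_trans r1.
  rewrite /inve gt_eqF//=.
  have S0 : 0 <= \sum_i `|x 0 i| `^ r by apply: sumr_ge0 => j _; exact: powR_ge0.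
  split => [h|h].
    have := @ge0_ler_powR _ r (ltW r0) _ _ _ _ h.
    rewrite -!powRrM mulVf ?gt_eqF// !powRr1//; apply; rewrite nnegrE powR_ge0//.
  by apply: ge0_ler_powR; rewrite ?invr_ge0 ?(ltW r0) ?nnegrE.
move=> _ n0; rewrite /inve /= powRr0; split => [h i|h].
  by apply: le_trans h; exact: le_bigmax.
exact: bigmax_le.
Qed.

Lemma lp_ball_convex p x y t : (1 <= p)%E -> (0 < n)%N -> 0 <= t <= 1 ->
  lp_norm p x <= ones_norm p -> lp_norm p y <= ones_norm p ->
  lp_norm p (t *: x + (1 - t) *: y) <= ones_norm p.
Proof.
move=> p1 n0 t01; rewrite !lp_norm_le_ones//; have /andP[t0 t1] := t01.
have t1' : 0 <= 1 - t by rewrite subr_ge0.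
have coord i : `|(t *: x + (1 - t) *: y) 0 i| <= t * `|x 0 i| + (1 - t) * `|y 0 i|.
  by rewrite !mxE; apply: le_trans (ler_normD _ _) _; rewrite !normrM (ger0_norm t0) (ger0_norm t1').
case: p p1 => [r| |] // p1; last first.
  by move=> x1 y1 i; apply: le_trans (coord i) _; have := x1 i; have := y1 i; nra.
rewrite lee_fin in p1; have r0 : 0 < r by exact: lt_le_trans p1.
move=> xn yn.
apply: (@le_trans _ _ (t * \sum_i `|x 0 i| `^ r + (1 - t) * \sum_i `|y 0 i| `^ r)); last by nra.
rewrite !mulr_sumr -big_split; apply: ler_sum => i _ /=.
apply: (@le_trans _ _ ((t * `|x 0 i| + (1 - t) * `|y 0 i|) `^ r)).
  apply: ge0_ler_powR; rewrite ?nnegrE ?(ltW r0)//.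
  by rewrite addr_ge0// mulr_ge0.
have := @convex_powR R r p1 (Itv01 t0 t1) `|x 0 i| `|y 0 i|.
rewrite !inE /= !in_itv /= !andbT !normr_ge0 => /(_ isT isT).
by rewrite !convRE /=.
Qed.

Lemma lp_ball_cube p x : (1 <= p)%E -> (0 < n)%N ->
  (forall i, `|x 0 i| <= 1) -> lp_norm p x <= ones_norm p.
Proof.
move=> p1 n0 x1; rewrite lp_norm_le_ones//; case: p p1 => [r| |]// p1.
rewrite lee_fin in p1; have r0 : 0 < r by exact: lt_le_trans p1.
apply: (@le_trans _ _ (\sum_(i < n) 1)); last by rewrite sumr_const card_ord.
apply: ler_sum => i _; apply: (@le_trans _ _ (1 `^ r)); last by rewrite powR1.
by apply: ge0_ler_powR; rewrite ?nnegrE ?(ltW r0).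
Qed.

End LpNorm.

(** * Rescaling *)

Section Main.
Context {R : realType}.

Lemma proj_perpZ n (a : R) (x y : 'rV[R]_n) : a != 0 ->
  proj_perp (a *: x) y = proj_perp x y.
Proof.
move=> a0; have [xx0|xx] := eqVneq (dotp x x) 0.
  by rewrite (dotp_eq0 xx0) scaler0.
apply/rowP => i; rewrite /proj_perp dotpZl !dotpZr !mxE; field.
by rewrite xx a0.
Qed.

Lemma vol_scale n s (a : R) (A : set 'rV[R]_n) : 0 < a ->
  (hausdorff_measure s A \is a fin_num) ->
  vol s ((fun y => a *: y) @` A) = (a ^+ s * hmeas s A / kappa s)%:E.
Proof.
move=> a0 fA; rewrite /vol kappaE.
rewrite (_ : (fun y => a *: y) = (fun y => a *: y + 0)); last by apply/funext => y; rewrite addr0.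
rewrite hausdorff_homothety// -(fineK fA) -/(hmeas s A) /inve gt_eqF ?kappa_gt0//.
Qed.

(** The norm is n^(1/p) times the gauge of the rounded body. The lower bound 1/2 for
it comes from body r `<=` L + L. *)
Theorem scaled_unit_ball m (p : \bar R) : (1 <= p)%E ->
  exists N : 'rV[R]_m.+1 -> R, is_norm N /\
    forall x : 'rV[R]_m.+1, x != 0 ->
      2^-1 * lp_norm p x <= N x <= isoconst * lp_norm p x /\
      (vol m (proj_perp x @` unit_ball N) / vol m.+1 (unit_ball N)
         <= (isoconst * m.+1%:R `^ fine (p^-1)%E)%:E)%E.
Proof.
move=> p1; pose c := @ones_norm R m.+1 p.
have c0 : 0 < c by rewrite powR_gt0.
pose L : set 'rV[R]_m.+1 := [set x | lp_norm p x <= c].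
have Lc (x : 'rV[R]_m.+1) : (forall i, `|x 0 i| <= 1) -> L x by exact: lp_ball_cube.
have Lconv x y t : 0 <= t <= 1 -> L x -> L y -> L (t *: x + (1 - t) *: y).
  by move=> t01; exact: lp_ball_convex.
have bL : bounded L by exists c => x i; apply: le_trans; exact: coord_le_lp.
have Lsym s q x : injective q -> L x -> L (sperm s q x).
  by move=> qinj; rewrite /L /= lp_norm_sperm.
have [N [Nnorm bN LN NL iso]] := smoothed_unit_ball Lconv Lsym Lc bL.
have N0 x : 0 <= N x.
  have h : N (x + - x) <= N x + N (- x) by exact: norm_triangle.
  have Nx0 : N 0 = 0 by rewrite -(scale0r (0 : 'rV[R]_m.+1)) (norm_homogeneous Nnorm) normr0 mul0r.
  have NN : N (- x) = N x by rewrite -scaleN1r (norm_homogeneous Nnorm) normrN1 mul1r.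
  by move: h; rewrite subrr Nx0 NN; lra.
have NV t x : 0 < t -> N (t^-1 *: x) = N x / t.
  by move=> t0; rewrite (norm_homogeneous Nnorm) gtr0_norm ?invr_gt0// mulrC.
have lpV t x : 0 < t -> lp_norm p (t^-1 *: x) = lp_norm p x / t.
  by move=> t0; rewrite lp_normZ// gtr0_norm ?invr_gt0// mulrC.
have N_le x : c * N x <= lp_norm p x.
  apply/ler_addgt0Pr => e e0; have t0 : 0 < lp_norm p x + e by rewrite ltr_wpDl// lp_norm_ge0.
  have : N (((lp_norm p x + e) / c)^-1 *: x) <= 1.
    apply: LN; rewrite /L /= lpV ?divr_gt0// invf_div mulrCA ger_pMr// ler_pdivrMr//.
    by rewrite mul1r lerDl ltW.
  by rewrite NV ?divr_gt0// invf_div mulrA ler_pdivrMr// mul1r mulrC.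
have N_ge x : 2^-1 * lp_norm p x <= c * N x.
  apply/ler_addgt0Pr => e e0.
  pose t := N x + e / c.
  have t0 : 0 < t by rewrite ltr_wpDl// divr_gt0.
  have [|w [v [Lw v1 xE]]] := NL (t^-1 *: x).
    by rewrite NV// ltr_pdivrMr// mul1r ltrDl divr_gt0.
  have : L (2^-1 *: w + (1 - 2^-1) *: v).
    apply: Lconv => //; last by apply: Lc => i; exact: ltW.
    by rewrite invr_ge0 ler0n invf_le1// ler1n.
  have -> : 2^-1 *: w + (1 - 2^-1) *: v = (2 * t)^-1 *: x.
    have -> : 1 - 2^-1 = 2^-1 :> R by field.
    by rewrite invfM -scalerA xE scalerDr.
  rewrite /L /= lpV ?mulr_gt0// ler_pdivrMr ?mulr_gt0// => h.
  rewrite ler_pdivrMl//; apply: le_trans h _; rewrite le_eqVlt; apply/orP; left.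
  by rewrite /t; apply/eqP; field; rewrite gt_eqF.
have ball : unit_ball (fun x => c * N x) = (fun y => c^-1 *: y) @` unit_ball N.
  rewrite predeqE => x; split => [Nx|[y Ny <-]].
    exists (c *: x); last by rewrite scalerA mulVf ?scale1r// gt_eqF.
    by rewrite /unit_ball /= (norm_homogeneous Nnorm) gtr0_norm.
  by rewrite /unit_ball /= NV// mulrCA divff ?mulr1// gt_eqF.
exists (fun x => c * N x); split.
  split => [x y|a x|x].
  - by rewrite -mulrDr ler_pM2l// norm_triangle.
  - by rewrite (norm_homogeneous Nnorm) mulrCA.
  - by move=> /eqP; rewrite mulf_eq0 (gt_eqF c0)/= => /eqP; exact: norm_definite.
move=> x x0; split.
  rewrite N_ge /=; apply: le_trans (N_le x) _; rewrite ler_peMl ?lp_norm_ge0// /isoconst.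
  by lra.
have xx : 0 < dotp x x.
  rewrite lt_neqAle; apply/andP; split; last first.
    by apply: sumr_ge0 => i _; rewrite -expr2 sqr_ge0.
  by rewrite eq_sym; apply: contra x0 => /eqP/dotp_eq0 ->.
(* The shadow depends on the direction of x only. *)
pose a := (Num.sqrt (dotp x x))^-1.
have a0 : 0 < a by rewrite invr_gt0 sqrtr_gt0.
have uu : dotp (a *: x) (a *: x) = 1.
  rewrite dotpZl dotpZr mulrA -expr2 /a exprVn sqr_sqrtr ?(ltW xx)//.
  by rewrite mulVf// gt_eqF.
have -> : proj_perp x @` unit_ball (fun y => c * N y) =
    (fun y => c^-1 *: y) @` (proj_perp (a *: x) @` unit_ball N).
  rewrite ball !image_comp; apply: eq_imagel => y _ /=.
  rewrite proj_perpZ ?gt_eqF//; apply/rowP => i.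
  by rewrite /proj_perp dotpZl !mxE; ring.
have cV0 : 0 < c^-1 by rewrite invr_gt0.
have finP : hausdorff_measure m (proj_perp (a *: x) @` unit_ball N) \is a fin_num.
  by rewrite ge0_fin_numE ?hausdorff_ge0// hausdorff_proj_fin.
rewrite ball !vol_scale//; last by rewrite hmeasE.
set P := hmeas m _; set b := hmeas m.+1 _.
have b0 : 0 < b.
  apply: lt_le_trans (kappa_gt0 m.+1) _; apply: le_hmeas => // z z01.
  apply: LN; apply: Lc => i; have /andP[z0 z1] := z01 i.
  by rewrite ger0_norm.
have km := kappa_gt0 (R := R) m; have kn := kappa_gt0 (R := R) m.+1.
rewrite /inve gt_eqF ?divr_gt0 ?mulr_gt0 ?exprn_gt0// -EFinM lee_fin -/c.
have -> : c^-1 ^+ m * P / kappa m / (c^-1 ^+ m.+1 * b / kappa m.+1) =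
    (P * kappa m.+1) / (kappa m * b) * c.
  by rewrite exprS; field; rewrite !gt_eqF ?exprn_gt0.
rewrite ler_pM2r// ler_pdivrMr ?mulr_gt0// mulrA.
exact: iso.
Qed.

End Main.

Theorem theorem24 (R : realType) :
  exists c C : R, [/\ 0 < c, 0 < C &
    forall (n : nat) (p : \bar R), (0 < n)%N -> (1 <= p)%E ->
      exists N : 'rV[R]_n -> R, is_norm N /\
        forall x : 'rV[R]_n, x != 0 ->
          c * lp_norm p x <= N x <= C * lp_norm p x /\
          (vol n.-1 (proj_perp x @` unit_ball N) / vol n (unit_ball N)
             <= (C * n%:R `^ fine (p^-1)%E)%:E)%E].
Proof.
exists 2^-1, isoconst; split => //.
  by rewrite /isoconst; lra.
by move=> [|m] p // _; exact: scaled_unit_ball.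
Qed.
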